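(* Let $\mathbb{F}$ be a field and let $\mathcal{M}$ be a conditional oriented matroid on a finite ground set $\mathcal{I}$. Let $\mathcal{Z}_{\mathcal{M}}$ be the big locus of $\mathcal{M}$, let $\widehat{S} = \mathbb{F}[y_i^+, y_i^-, z_i : i \in \mathcal{I}]$, let $\mathbf{R}(\mathcal{Z}_{\mathcal{M}}) = \widehat{S}/\mathrm{gr}\,\mathbf{I}(\mathcal{Z}_{\mathcal{M}})$, and let $\widehat{I}_{\mathcal{M}} \subseteq \widehat{S}$ be the ideal defined in the context. Fix a total order $<$ on $\mathcal{I}$ and a basic set $B(F)$ for each flat $F \in \mathcal{L}(\mathcal{M})$, and let $\widehat{\mathcal{N}} \subseteq \widehat{S}$ be the resulting set of monomials defined in the context. Then: (a) One has the equality of ideals $\widehat{I}_{\mathcal{M}} = \mathrm{gr}\,\mathbf{I}(\mathcal{Z}_{\mathcal{M}})$ in $\widehat{S}$, so that $\mathbf{R}(\mathcal{Z}_{\mathcal{M}}) = \widehat{S}/\widehat{I}_{\mathcal{M}}$. (b) The set $\widehat{\mathcal{N}}$ descends to an $\mathbb{F}$-vector space basis of $\mathbf{R}(\mathcal{Z}_{\mathcal{M}})$. (c) There is an isomorphism of graded $\mathbb{F}$-vector spaces $$\mathbf{R}(\mathcal{Z}_{\mathcal{M}}) \cong \bigoplus_{F \in \mathcal{L}(\mathcal{M})} \mathbf{R}(\mathcal{Y}_{\mathcal{M}^F})(-\mathrm{codim}(F)),$$ where $\mathbf{R}(\mathcal{Y}_{\mathcal{M}^F})(-d)$ is the graded vector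 space $\mathbf{R}(\mathcal{Y}_{\mathcal{M}^F})$ with degree shifted up by $d$.
   Context: **Conditional oriented matroids.** Let $\mathcal{I}$ be a finite set. A signed subset of $\mathcal{I}$ is a function $X : \mathcal{I} \to \{+,-,0\}$; its support is $\mathrm{Supp}(X) = \{i : X(i) \neq 0\}$, and $-X$ is obtained by exchanging $+$ and $-$. For signed subsets $X, Y$: $\mathrm{Sep}(X,Y) = \{i : X(i) = -Y(i) \neq 0\}$, and $(X \circ Y)(i) = X(i)$ if $X(i) \neq 0$, $(X\circ Y)(i) = Y(i)$ otherwise. A conditional oriented matroid on $\mathcal{I}$ is a family $\mathcal{M}$ of signed subsets of $\mathcal{I}$ (called covectors) such that (Face Symmetry) $X, Y \in \mathcal{M}$ implies $X \circ (-Y) \in \mathcal{M}$; and (Strong Elimination) if $X,Y \in \mathcal{M}$ and $i \in \mathrm{Sep}(X,Y)$, there is $Z \in \mathcal{M}$ with $Z(i) = 0$ and $Z(j) = (X\circ Y)(j)$ for all $j \in \mathcal{I} - \mathrm{Sep}(X,Y)$. A tope is a covector $X$ with $X(i) \neq 0$ for all $i \in \mathcal{I}$; $\mathcal{T}(\mathcal{M})$ is the set of topes. **Flats and contraction.** For $X \in \mathcal{M}$, $\mathrm{Flat}(X) = \{i \in \mathcal{I} : X(i) = 0\}$. The poset of flats is $\mathcal{L}(\mathcal{M}) = \{\mathrm{Flat}(X) : X \in \mathcal{M}\}$, ordered by containment; it is closed under intersection. For $F \in \mathcal{L}(\mathcal{M})$, the contraction $\mathcal{M}^F = \{X|_{\mathcal{I}-F}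 : X \in \mathcal{M},\ X(i) = 0 \text{ for all } i \in F\}$ is a conditional oriented matroid on $\mathcal{I} - F$. **Basic sets.** If $C \subseteq \mathcal{I}$ is contained in at least one flat, $\overline{C}$ denotes the containment-minimal flat containing $C$; otherwise $\overline{C}$ is undefined. A subset $B \subseteq F$ is basic for the flat $F$ if $\overline{B} = F$, and $C \subseteq B$ with $\overline{C} = F$ implies $C = B$. Every flat has a basic set, and all basic sets of $F$ have the same cardinality, denoted $\mathrm{codim}(F)$. A subset $C \subseteq \mathcal{I}$ is nonbasic if it is not basic for any flat. **Circuits and NBC sets.** A signed set $Z$ is a proper signed subset of $X$ if $Z \neq X$ and $Z(i) \in \{0, X(i)\}$ for all $i$. A signed set $X : \mathcal{I} \to \{+,-,0\}$ is a circuit of $\mathcal{M}$ if (1) $X \circ Y \neq Y$ for all $Y \in \mathcal{M}$, and (2) for every proper signed subset $Z$ of $X$ there is $Y_0 \in \mathcal{M}$ with $Z \circ Y_0 = Y_0$. A circuit $X$ is symmetric if $-X$ is also a circuit. Given a total order $<$ on $\mathcal{I}$ (restricted to $\mathcal{I}-F$ when considering $\mathcal{M}^F$), a subset $N$ of the ground set is an NBC (no broken circuit) set if $\mathrm{Supp}(X) \not\subseteq N$ for every circuit $X$, and $\mathrm{Supp}(X)^\circ \not\subseteq N$ for every symmetric circuit $X$, where $\mathrm{Supp}(X)^\circ$ is $\mathrm{Supp}(X)$ with its $<$-smallest element removed. $\mathcal{N}(\mathcal{M})$ is the family of NBC sets of $\mathcal{M}$. **Orbit harmonics.** For a finite set $\mathcal{Z}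 \subseteq \mathbb{F}^N$ with coordinate ring $R = \mathbb{F}[x_1,\dots,x_N]$, $\mathbf{I}(\mathcal{Z}) \subseteq R$ is the ideal of polynomials vanishing on $\mathcal{Z}$; $\mathrm{gr}\,\mathbf{I}(\mathcal{Z})$ is the homogeneous ideal generated by the top-degree homogeneous components $\tau(f)$ of nonzero $f \in \mathbf{I}(\mathcal{Z})$; and $\mathbf{R}(\mathcal{Z}) = R/\mathrm{gr}\,\mathbf{I}(\mathcal{Z})$, a graded algebra. **Loci.** The small locus $\mathcal{Y}_{\mathcal{M}} \subseteq \mathbb{F}^{\mathcal{I} \times \{+,-\}}$ is $\{\mathbf{y}_X : X \in \mathcal{T}(\mathcal{M})\}$, with $(\mathbf{y}_X)_{i,s} = 1$ if $X(i) = s$ and $0$ otherwise; the coordinate ring is $\mathbb{F}[y_i^+,y_i^- : i \in \mathcal{I}]$. (For $\mathcal{M}^F$, replace $\mathcal{I}$ by $\mathcal{I}-F$.) The big locus $\mathcal{Z}_{\mathcal{M}} \subseteq \mathbb{F}^{\mathcal{I} \times \{+,-,0\}}$ is $\{\mathbf{z}_X : X \in \mathcal{M}\}$, with $(\mathbf{z}_X)_{i,s} = 1$ if $X(i)=s$ and $0$ otherwise; the coordinate ring is $\widehat{S} = \mathbb{F}[y_i^+,y_i^-,z_i : i \in \mathcal{I}]$, where $y_i^+, y_i^-, z_i$ are the coordinates indexed by $(i,+),(i,-),(i,0)$. **The ideals.** $\widetilde{I}_{\mathcal{M}} \subseteq \widehat{S}$ is generated by: $\prod_{c \in C} z_c$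 for every nonbasic $C \subseteq \mathcal{I}$; $\prod_{b \in B} z_b - \prod_{b' \in B'} z_{b'}$ for any two basic sets $B,B'$ of the same flat; and $z_i^2$ for each $i \in \mathcal{I}$. For a flat $F$, $z_F \in \widehat{S}/\widetilde{I}_{\mathcal{M}}$ is the class of $\prod_{b \in B} z_b$ for any basic set $B$ of $F$. The ideal $\widehat{I}_{\mathcal{M}} \subseteq \widehat{S}$ is the full preimage under $\widehat{S} \to \widehat{S}/\widetilde{I}_{\mathcal{M}}$ of the ideal generated by: (1) all degree two monomials in $\{y_i^+,y_i^-,z_i\}$, for each $i \in \mathcal{I}$; (2) $y_i^+ + y_i^- + z_i$ for each $i \in \mathcal{I}$; (3) $z_F \cdot y_i^+$ and $z_F \cdot y_i^-$ for each flat $F$ and each $i \in F$; (4) $z_F \cdot \prod_{i \in \mathrm{Supp}(X)} y_i^{X(i)}$ for each flat $F$ and each circuit $X$ of $\mathcal{M}^F$; (5) for each flat $F$ and each symmetric circuit $X$ of $\mathcal{M}^F$, with $s = \#\mathrm{Supp}(X)$ (necessarily $s>1$), the element $z_F \cdot e_{s-1}(\tilde{y}_i : i \in \mathrm{Supp}(X))$, where $e_{s-1}$ is the elementary symmetric polynomial, $\varnothing \subsetneq J \subsetneq \mathrm{Supp}(X)$ is a fixed (arbitrarily chosen) nonempty proper subset, and $\tilde{y}_i = y_i^{X(i)} + z_i$ for $i \in J$, $\tilde{y}_i = y_i^{X(i)}$ for $i \in \mathrm{Supp}(X) - J$. **The monomials.** $\mathcal{N}_F = \{\prod_{i \in N}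 y_i^+ : N \in \mathcal{N}(\mathcal{M}^F)\}$ and $\widehat{\mathcal{N}} = \bigsqcup_{F \in \mathcal{L}(\mathcal{M})} \left(\prod_{b \in B(F)} z_b \cdot \mathcal{N}_F\right)$. *)

(* Defs.v *)
From HB Require Import structures.
From mathcomp Require Import all_boot all_order all_algebra.
From mathcomp Require Import boolp.
From mathcomp Require Import mpoly.

Set Implicit Arguments.
Unset Strict Implicit.
Unset Printing Implicit Defensive.

Import GRing.Theory.
Local Open Scope ring_scope.
Local Open Scope quotient_scope.

Section GeneratedIdeal.
Variables (K : fieldType) (A : comAlgType K).
Implicit Types (G : A -> Prop) (f g : A).

Definition ideal_gen G : {pred A} := fun f =>
  `[< exists2 s : seq (A * A),
        forall p, p \in s -> G p.2 & f = \sum_(p <- s) p.1 * p.2 >].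

Lemma ideal_genP G f :
  reflect (exists2 s : seq (A * A),
             forall p, p \in s -> G p.2 & f = \sum_(p <- s) p.1 * p.2)
          (f \in ideal_gen G).
Proof. exact: asboolP. Qed.

Lemma ideal_gen_mull G a f : f \in ideal_gen G -> a * f \in ideal_gen G.
Proof.
move=> /ideal_genP[s Gs ->]; apply/ideal_genP.
exists [seq (a * p.1, p.2) | p <- s].
  by move=> _ /mapP[p sp ->]; exact: Gs p sp.
by rewrite big_map mulr_sumr; apply: eq_bigr => p _; rewrite mulrA.
Qed.

Lemma ideal_gen_zmod_closed G : zmod_closed (ideal_gen G).
Proof.
split=> [|f g If].
  by apply/ideal_genP; exists [::]; [by []|rewrite big_nil].
move=> /(ideal_gen_mull (-1)); rewrite mulN1r => /ideal_genP[t Gt ->].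
case/ideal_genP: If => s Gs ->.
apply/ideal_genP; exists (s ++ t); last by rewrite big_cat.
by move=> p; rewrite mem_cat => /orP[/Gs|/Gt].
Qed.

HB.instance Definition _ G :=
  GRing.isZmodClosed.Build A (ideal_gen G) (ideal_gen_zmod_closed G).

(* The ideal may be all of [A], so this quotient is only given its vector space
   structure: MathComp's ring quotients require a proper ideal. *)
Definition quot_gen G : Type := Quotient.quot (ideal_gen G).

HB.instance Definition _ G := GRing.Zmodule.on (quot_gen G).

Definition quot_pi G (f : A) : quot_gen G := \pi_(Quotient.quot (ideal_gen G)) f.

Definition quot_scale G (c : K) (x : quot_gen G) : quot_gen G :=
  quot_pi G (c *: repr (x : Quotient.quot (ideal_gen G))).

Lemma quot_piP G f g : (quot_pi G f = quot_pi G g) <-> f - g \in ideal_gen G.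
Proof.
split=> [/eqP|Ifg]; first by rewrite /quot_pi piE Quotient.equivE.
by apply/eqP; rewrite /quot_pi piE Quotient.equivE.
Qed.

Lemma quot_pi_surj G (x : quot_gen G) : exists f, x = quot_pi G f.
Proof. by exists (repr (x : Quotient.quot (ideal_gen G))); rewrite /quot_pi reprK. Qed.

Lemma quot_piB G : {morph quot_pi G : f g / f - g}.
Proof. by move=> f g; rewrite /quot_pi raddfB. Qed.

Lemma quot_piD G : {morph quot_pi G : f g / f + g}.
Proof. by move=> f g; rewrite /quot_pi raddfD. Qed.

Lemma quot_scaleE G c f : quot_scale c (quot_pi G f) = quot_pi G (c *: f).
Proof.
apply/quot_piP; rewrite -scalerBr -mulr_algl; apply: ideal_gen_mull.
by apply/quot_piP; rewrite /quot_pi reprK.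
Qed.

Lemma quot_scaleA G a b (x : quot_gen G) :
  quot_scale a (quot_scale b x) = quot_scale (a * b) x.
Proof. by case: (quot_pi_surj x) => f ->; rewrite !quot_scaleE scalerA. Qed.

Lemma quot_scale1 G : left_id 1 (@quot_scale G).
Proof. by move=> x; case: (quot_pi_surj x) => f ->; rewrite quot_scaleE scale1r. Qed.

Lemma quot_scaleDr G : right_distributive (@quot_scale G) +%R.
Proof.
move=> a x y; case: (quot_pi_surj x) => f ->; case: (quot_pi_surj y) => g ->.
by rewrite -quot_piD !quot_scaleE -quot_piD scalerDr.
Qed.

Lemma quot_scaleDl G (x : quot_gen G) : {morph (@quot_scale G)^~ x : a b / a + b}.
Proof.
by move=> a b; case: (quot_pi_surj x) => f ->; rewrite !quot_scaleE -quot_piD scalerDl.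
Qed.

HB.instance Definition _ G := GRing.Zmodule_isLmodule.Build K (quot_gen G)
  (@quot_scaleA G) (@quot_scale1 G) (@quot_scaleDr G) (@quot_scaleDl G).

Lemma quot_pi_is_linear G : linear (quot_pi G).
Proof. by move=> a f g; rewrite quot_piD -quot_scaleE. Qed.

HB.instance Definition _ G :=
  GRing.isLinear.Build K A (quot_gen G) _ (quot_pi G) (quot_pi_is_linear G).

End GeneratedIdeal.

Section DirectProduct.
Variables (K : fieldType) (T : finType) (V : T -> lmodType K).
Implicit Types f g h : {dffun forall t, V t}.

Definition dprod_zero : {dffun forall t, V t} := [ffun t => 0].
Definition dprod_opp f : {dffun forall t, V t} := [ffun t => - f t].
Definition dprod_add f g : {dffun forall t, V t} := [ffun t => f t + g t].
Definition dprod_scale a f : {dffun forall t, V t} := [ffun t => a *: f t].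

Lemma dprod_addA : associative dprod_add.
Proof. by move=> f g h; apply/ffunP=> t; rewrite !ffunE addrA. Qed.
Lemma dprod_addC : commutative dprod_add.
Proof. by move=> f g; apply/ffunP=> t; rewrite !ffunE addrC. Qed.
Lemma dprod_add0 : left_id dprod_zero dprod_add.
Proof. by move=> f; apply/ffunP=> t; rewrite !ffunE add0r. Qed.
Lemma dprod_addN : left_inverse dprod_zero dprod_opp dprod_add.
Proof. by move=> f; apply/ffunP=> t; rewrite !ffunE addNr. Qed.

HB.instance Definition _ := GRing.isZmodule.Build {dffun forall t, V t}
  dprod_addA dprod_addC dprod_add0 dprod_addN.

Lemma dprod_scaleA a b f :
  dprod_scale a (dprod_scale b f) = dprod_scale (a * b) f.
Proof. by apply/ffunP=> t; rewrite !ffunE scalerA. Qed.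
Lemma dprod_scale1 : left_id 1 dprod_scale.
Proof. by move=> f; apply/ffunP=> t; rewrite !ffunE scale1r. Qed.
Lemma dprod_scaleDr : right_distributive dprod_scale +%R.
Proof. by move=> a f g; apply/ffunP=> t; rewrite !ffunE scalerDr. Qed.
Lemma dprod_scaleDl f : {morph dprod_scale^~ f : a b / a + b}.
Proof. by move=> a b; apply/ffunP=> t; rewrite !ffunE scalerDl. Qed.

HB.instance Definition _ := GRing.Zmodule_isLmodule.Build K
  {dffun forall t, V t} dprod_scaleA dprod_scale1 dprod_scaleDr dprod_scaleDl.

Lemma dprod_sumE (J : Type) (r : seq J) (P : pred J)
    (w : J -> {dffun forall t, V t}) t :
  (\sum_(j <- r | P j) w j) t = \sum_(j <- r | P j) w j t.
Proof.
apply: (big_morph (fun f : {dffun forall t, V t} => f t)); last by rewrite ffunE.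
by move=> f g; rewrite ffunE.
Qed.

End DirectProduct.

(* An internal grading: the carrier is the direct sum of the subspaces
   [gpiece d], for [d : nat]. *)
Record gradedModule (K : fieldType) := GradedModule {
  gcarrier :> lmodType K;
  gpiece : nat -> {pred gcarrier};
  gpiece_submod : forall d, submod_closed (gpiece d);
  gpiece_span : forall v : gcarrier,
    exists n, exists2 w : nat -> gcarrier,
      forall d, w d \in gpiece d & v = \sum_(d < n) w d;
  gpiece_direct : forall n (w : nat -> gcarrier),
    (forall d, w d \in gpiece d) -> \sum_(d < n) w d = 0 ->
    forall d, (d < n)%N -> w d = 0
}.

Arguments gpiece {K} g d _ : rename.

Definition graded_iso (K : fieldType) (V W : gradedModule K) : Prop :=
  exists2 phi : {linear V -> W}, bijective phi &
    forall d v, (phi v \in gpiece W d) = (v \in gpiece V d).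

Section Shift.
Variables (K : fieldType) (V : gradedModule K) (c : nat).

Definition shift_piece d : {pred V} :=
  fun v => if (c <= d)%N then v \in gpiece V (d - c) else v == 0.

Lemma shift_pieceE d v :
  (v \in shift_piece d) = if (c <= d)%N then v \in gpiece V (d - c) else v == 0.
Proof. by []. Qed.

Lemma gpiece0 d : 0 \in gpiece V d.
Proof. by case: (gpiece_submod V d). Qed.

Lemma shift_piece_submod d : submod_closed (shift_piece d).
Proof.
split=> [|a u v]; rewrite !shift_pieceE; case: ifP => _.
- exact: gpiece0.
- exact: eqxx.
- by case: (gpiece_submod V (d - c)) => _; apply.
- by move=> /eqP-> /eqP->; rewrite scaler0 addr0.
Qed.

Lemma shift_piece_span (v : V) :
  exists n, exists2 w : nat -> V,
    forall d, w d \in shift_piece d & v = \sum_(d < n) w d.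
Proof.
have [n [w wP ->]] := gpiece_span v.
exists (c + n)%N; exists (fun d => if (c <= d)%N then w (d - c)%N else 0).
  by move=> d; rewrite shift_pieceE; case: (c <= d)%N; [exact: wP | exact: eqxx].
rewrite big_split_ord /= [X in _ = X + _]big1 ?add0r => [|i _].
  by apply: eq_bigr => i _; rewrite leq_addr addKn.
by rewrite leqNgt ltn_ord.
Qed.

Lemma shift_piece_direct n (w : nat -> V) :
  (forall d, w d \in shift_piece d) -> \sum_(d < n) w d = 0 ->
  forall d, (d < n)%N -> w d = 0.
Proof.
move=> wP sw d dn; have := wP d; rewrite shift_pieceE.
case: leqP => [cd _|_ /eqP//]; have cn := leq_ltn_trans cd dn.
have w'P k : w (c + k)%N \in gpiece V k.
  by have := wP (c + k)%N; rewrite shift_pieceE leq_addr addKn.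
move: cn dn sw => /ltnW/subnKC <-; move: (n - c)%N => m dm sw.
have sw' : \sum_(k < m) w (c + k)%N = 0.
  apply: etrans sw; rewrite big_split_ord /= [X in _ = X + _]big1 ?add0r // => i _.
  by have := wP i; rewrite shift_pieceE leqNgt ltn_ord => /eqP.
rewrite -(subnKC cd); apply: (gpiece_direct w'P sw').
by rewrite -(ltn_add2l c) subnKC.
Qed.

Definition gshift : gradedModule K :=
  GradedModule shift_piece_submod shift_piece_span shift_piece_direct.

End Shift.

Section DirectSum.
Variables (K : fieldType) (T : finType) (V : T -> gradedModule K).

Definition dsum_piece d : {pred {dffun forall t, V t}} :=
  fun f => [forall t, f t \in gpiece (V t) d].

Lemma dsum_pieceP d (f : {dffun forall t, V t}) :
  reflect (forall t, f t \in gpiece (V t) d) (f \in dsum_piece d).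
Proof. exact: forallP. Qed.

Lemma dsum_piece_submod d : submod_closed (dsum_piece d).
Proof.
split=> [|a f g /dsum_pieceP fP /dsum_pieceP gP]; apply/dsum_pieceP => t.
  by rewrite ffunE gpiece0.
by rewrite !ffunE; case: (gpiece_submod (V t) d) => _; apply.
Qed.

Lemma dsum_piece_span (f : {dffun forall t, V t}) :
  exists n, exists2 w : nat -> {dffun forall t, V t},
    forall d, w d \in dsum_piece d & f = \sum_(d < n) w d.
Proof.
have /all_sig2 : forall t, {nw : nat * (nat -> V t) |
    (forall d, nw.2 d \in gpiece (V t) d) & f t = \sum_(d < nw.1) nw.2 d}.
  move=> t; apply: cid2; have [n [w wP fE]] := gpiece_span (f t).
  by exists (n, w).
case=> nw wP fE; exists (\max_t (nw t).1).
exists (fun d => [ffun t => if (d < (nw t).1)%N then (nw t).2 d else 0]).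
  move=> d; apply/dsum_pieceP => t; rewrite ffunE.
  by case: ifP => _; [exact: wP | exact: gpiece0].
apply/ffunP => t; rewrite dprod_sumE fE.
rewrite (big_ord_widen _ (nw t).2 (@leq_bigmax _ (fun t => (nw t).1) t)) big_mkcond.
by apply: eq_bigr => d _; rewrite ffunE.
Qed.

Lemma dsum_piece_direct n (w : nat -> {dffun forall t, V t}) :
  (forall d, w d \in dsum_piece d) -> \sum_(d < n) w d = 0 ->
  forall d, (d < n)%N -> w d = 0.
Proof.
move=> wP sw d dn; apply/ffunP => t; rewrite [RHS]ffunE.
apply: (@gpiece_direct K (V t) n (fun d => w d t)) => // [k|].
  exact/dsum_pieceP.
by have := congr1 (fun f : {dffun forall t, V t} => f t) sw; rewrite dprod_sumE ffunE.
Qed.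

Definition gdsum : gradedModule K :=
  GradedModule dsum_piece_submod dsum_piece_span dsum_piece_direct.

End DirectSum.

Section GradedQuotient.
Variables (K : fieldType) (n : nat) (G : {mpoly K[n]} -> Prop).
Hypothesis G_homog : forall g, G g -> exists d, g \is d.-homog.

Definition quot_piece d : {pred quot_gen G} :=
  fun x => `[< exists2 f, f \is d.-homog & x = quot_pi G f >].

Lemma quot_pieceP d (x : quot_gen G) :
  reflect (exists2 f, f \is d.-homog & x = quot_pi G f) (x \in quot_piece d).
Proof. exact: asboolP. Qed.

Lemma ideal_gen_pihomog d f :
  f \in ideal_gen G -> pihomog mdeg d f \in ideal_gen G.
Proof.
case/ideal_genP=> s Gs ->; rewrite raddf_sum big_seq.
apply: rpred_sum => -[a g] /Gs /= Gg; have [e ge] := G_homog Gg.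
have Ig : g \in ideal_gen G.
  apply/ideal_genP; exists [:: (1, g)]; last by rewrite big_seq1 mul1r.
  by move=> p; rewrite inE => /eqP->.
rewrite {1}(pihomog_partitionE (leqnn (msize a))) mulr_suml raddf_sum.
apply: rpred_sum => k _ /=; have hk := dhomogM (pihomogP mdeg k a) ge.
have [kd|kd] := eqVneq (k + e)%N d; last by rewrite (pihomog_ne0 kd hk) rpred0.
by rewrite pihomog_dE -?kd // ideal_gen_mull.
Qed.

Lemma quot_piece_submod d : submod_closed (quot_piece d).
Proof.
split=> [|a x y /quot_pieceP[f hf ->] /quot_pieceP[g hg ->]]; apply/quot_pieceP.
  by exists 0; [exact: dhomog0 | rewrite raddf0].
exists (a *: f + g); last by rewrite linearP.
by rewrite rpredD // rpredZ.
Qed.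

Lemma quot_piece_span (x : quot_gen G) :
  exists m, exists2 w : nat -> quot_gen G,
    forall d, w d \in quot_piece d & x = \sum_(d < m) w d.
Proof.
have [f ->] := quot_pi_surj x.
exists (msize f); exists (fun d => quot_pi G (pihomog mdeg d f)).
  by move=> d; apply/quot_pieceP; exists (pihomog mdeg d f); rewrite ?pihomogP.
by rewrite -raddf_sum -pihomog_partitionE.
Qed.

Lemma quot_piece_direct m (w : nat -> quot_gen G) :
  (forall d, w d \in quot_piece d) -> \sum_(d < m) w d = 0 ->
  forall d, (d < m)%N -> w d = 0.
Proof.
move=> wP; have /all_sig2[f fh fE] d : {f | f \is d.-homog & w d = quot_pi G f}.
  exact/cid2/quot_pieceP.
rewrite (eq_bigr (fun d : 'I_m => quot_pi G (f d))) // -raddf_sum => sw d dm.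
have : \sum_(k < m) f k \in ideal_gen G.
  by rewrite -[X in X \in _]subr0; apply/quot_piP; rewrite raddf0.
move=> /(ideal_gen_pihomog d); rewrite raddf_sum (bigD1 (Ordinal dm)) //=.
rewrite pihomog_dE // big1 ?addr0 => [|k kd]; last first.
  exact: pihomog_ne0 kd (fh k).
by move=> Ifd; rewrite fE -(raddf0 (quot_pi G)); apply/quot_piP; rewrite subr0.
Qed.

Definition graded_quot : gradedModule K :=
  GradedModule quot_piece_submod quot_piece_span quot_piece_direct.

End GradedQuotient.

(* The independence clause makes the entries of [s] pairwise distinct. *)
Definition is_basis (K : fieldType) (V : lmodType K) (s : seq V) : Prop :=
  (forall v, exists c : 'I_(size s) -> K, v = \sum_i c i *: s`_i) /\
  (forall c : 'I_(size s) -> K, \sum_i c i *: s`_i = 0 -> forall i, c i = 0).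

(* Multinomials' variables are indexed by ordinals; a coordinate [t : T] is
   identified with its rank [enum_rank t]. *)
Notation coordRing K T := {mpoly K[#|{: T}|]}.

Definition cvar (K : fieldType) (T : finType) (t : T) : coordRing K T :=
  'X_(enum_rank t).

Section OrbitHarmonics.
Variables (K : fieldType) (T : finType).
Implicit Types (Z : seq {ffun T -> K}) (f g : coordRing K T).

Definition peval (v : {ffun T -> K}) f : K := f.@[fun k => v (enum_val k)].

Definition vanishing_ideal Z : {pred coordRing K T} :=
  fun f => all (fun v => peval v f == 0) Z.

Definition top_form f : coordRing K T := pihomog mdeg (msize f).-1 f.

Definition top_forms Z g : Prop :=
  exists f, [/\ f != 0, f \in vanishing_ideal Z & g = top_form f].

Definition gr_ideal Z : {pred coordRing K T} := ideal_gen (top_forms Z).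

Lemma top_forms_homog Z g : top_forms Z g -> exists d, g \is d.-homog.
Proof. by case=> f [_ _ ->]; exists (msize f).-1; exact: pihomogP. Qed.

Definition orbit_harmonics Z : gradedModule K :=
  graded_quot (@top_forms_homog Z).

Definition orbit_pi Z f : orbit_harmonics Z := quot_pi (top_forms Z) f.

End OrbitHarmonics.

(* Signs are encoded as [Some true] for +, [Some false] for - and [None] for 0,
   so that the coordinates of the small locus are indexed by [I * bool] and
   those of the big locus by [I * option bool]. *)
Notation signed I := {ffun I -> option bool}.

Definition sign_opp (s : option bool) : option bool := omap negb s.

Section COM.
Variable I : finType.
Implicit Types (X Y Z : signed I) (M : {set signed I}) (F B C N : {set I}).

Definition supp X : {set I} := [set i | X i != None].

Definition sopp X : signed I := [ffun i => sign_opp (X i)].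

Definition sep X Y : {set I} :=
  [set i | (X i == sign_opp (Y i)) && (X i != None)].

Definition scomp X Y : signed I := [ffun i => if X i != None then X i else Y i].

Definition face_symmetry M : Prop :=
  forall X Y, X \in M -> Y \in M -> scomp X (sopp Y) \in M.

Definition strong_elimination M : Prop :=
  forall X Y i, X \in M -> Y \in M -> i \in sep X Y ->
  exists2 Z, Z \in M &
    Z i = None /\ forall j, j \notin sep X Y -> Z j = scomp X Y j.

Definition is_COM M : Prop := face_symmetry M /\ strong_elimination M.

Definition topes M : {set signed I} := [set X in M | [forall i, X i != None]].

Definition flat_of X : {set I} := [set i | X i == None].

Definition flats M : {set {set I}} := [set flat_of X | X in M].

Definition restrict F X : signed {i : I | i \notin F} := [ffun i => X (val i)].

Definition contraction M F : {set signed {i : I | i \notin F}} :=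
  [set restrict F X | X in M & F \subset flat_of X].

(* [closure_is M C F] says that the closure of [C] is defined and equal to [F];
   as the flats of a COM are closed under intersection, there is at most one
   such [F]. *)
Definition closure_is M C F : bool :=
  minset (fun G => (G \in flats M) && (C \subset G)) F.

Definition basic M F B : bool :=
  [&& B \subset F, closure_is M B F &
      [forall C : {set I}, (C \subset B) && closure_is M C F ==> (C == B)]].

Definition nonbasic M C : bool := ~~ [exists F, basic M F C].

(* The common cardinality of the basic sets of [F]. *)
Definition codim M F : nat := if [pick B | basic M F B] is Some B then #|B| else 0.

Definition proper_signed Z X : bool :=
  (Z != X) && [forall i, (Z i == None) || (Z i == X i)].

Definition circuit M X : bool :=
  [forall Y in M, scomp X Y != Y] &&
  [forall Z, proper_signed Z X ==> [exists Y in M, scomp Z Y == Y]].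

Definition symmetric_circuit M X : bool := circuit M X && circuit M (sopp X).

Definition drop_smallest (le : rel I) (S : {set I}) : {set I} :=
  [set i in S | ~~ [forall j in S, le i j]].

Definition NBC M (le : rel I) : {set {set I}} :=
  [set N : {set I} |
     [forall X, circuit M X ==> ~~ (supp X \subset N)] &&
     [forall X, symmetric_circuit M X ==>
        ~~ (drop_smallest le (supp X) \subset N)]].

End COM.

Definition total_order (T : Type) (le : rel T) : Prop :=
  [/\ total le, transitive le & antisymmetric le].

Definition ground_le (I : finType) (F : {set I}) (le : rel I) :
    rel {i : I | i \notin F} :=
  fun i j => le (val i) (val j).

Section Loci.
Variables (K : fieldType) (I : finType).

Definition ypoint (X : signed I) : {ffun I * bool -> K} :=
  [ffun p => (X p.1 == Some p.2)%:R].

Definition small_locus (M : {set signed I}) : seq {ffun I * bool -> K} :=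
  [seq ypoint X | X in topes M].

Definition zpoint (X : signed I) : {ffun I * option bool -> K} :=
  [ffun p => (X p.1 == p.2)%:R].

Definition big_locus (M : {set signed I}) : seq {ffun I * option bool -> K} :=
  [seq zpoint X | X in M].

End Loci.

Definition elem_sym (R : comNzRingType) (T : finType) (k : nat) (S : {set T})
    (t : T -> R) : R :=
  \sum_(A : {set T} | (A \subset S) && (#|A| == k)) \prod_(i in A) t i.

Section HatIdeal.
Variables (K : fieldType) (I : finType) (M : {set signed I}).

Local Notation S := (coordRing K (I * option bool)%type).
Local Notation v i s := (cvar K (i, s)).
Local Notation yplus i := (v i (Some true)).
Local Notation yminus i := (v i (Some false)).
Local Notation z i := (v i None).

Definition zprod (C : {set I}) : S := \prod_(c in C) z c.

Inductive tilde_gen : S -> Prop :=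
| TildeNonbasic C : nonbasic M C -> tilde_gen (zprod C)
| TildeBasic F B B' : basic M F B -> basic M F B' ->
    tilde_gen (zprod B - zprod B')
| TildeSquare i : tilde_gen (z i ^+ 2).

Definition tilde_ideal : {pred S} := ideal_gen tilde_gen.

Variable J : forall F : {set I},
  signed {i : I | i \notin F} -> {set {i : I | i \notin F}}.

(* In the quotient by [tilde_ideal], the class of [zprod B] does not depend on
   the basic set [B] of [F]; all of these lifts of z_F are used. For [i] in [supp X],
   [v (val i) (X i)] is the variable y_i^{X(i)}, as [X i] is not [None]. *)
Inductive hat_gen : S -> Prop :=
| HatQuad i s t : hat_gen (v i s * v i t)
| HatLinear i : hat_gen (yplus i + yminus i + z i)
| HatFlat F B i (s : bool) : basic M F B -> i \in F ->
    hat_gen (zprod B * v i (Some s))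
| HatCircuit F B X : basic M F B -> circuit (contraction M F) X ->
    hat_gen (zprod B * \prod_(i in supp X) v (val i) (X i))
| HatSymmetric F B X : basic M F B -> symmetric_circuit (contraction M F) X ->
    hat_gen (zprod B *
      elem_sym #|supp X|.-1 (supp X)
        (fun i => if i \in J X then v (val i) (X i) + z (val i)
                  else v (val i) (X i))).

(* The preimage in [S] of the ideal of [S / tilde_ideal] generated by the
   classes of [hat_gen]. *)
Definition hat_ideal : {pred S} :=
  fun f => `[< exists2 g, g \in ideal_gen hat_gen & f - g \in tilde_ideal >].

Variables (le : rel I) (B : {set I} -> {set I}).

Definition nbc_monomials (F : {set I}) : seq S :=
  [seq \prod_(i in N) yplus (val i) | N : {set {i : I | i \notin F}} in
     NBC (contraction M F) (@ground_le I F le)].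

Definition hat_monomials : seq S :=
  flatten [seq [seq zprod (B F) * m | m <- nbc_monomials F] | F in flats M].

End HatIdeal.

Arguments hat_ideal K {I} M J.
Arguments hat_monomials K {I} M le B.

(* Main.v *)
From HB Require Import structures.
Require Import Defs.
From mathcomp Require Import all_boot all_order all_algebra.
From mathcomp Require Import boolp mpoly ring.

Set Implicit Arguments.
Unset Strict Implicit.
Unset Printing Implicit Defensive.

Import GRing.Theory.

(** The proof compares two counts. On the one hand, the orbit harmonics quotient of
    a finite point set [Z] has dimension [#|Z|]; consequently a family of at most
    [#|Z|] homogeneous polynomials that spans the quotient is a basis of it, and if
    it already spans modulo a smaller ideal then the two ideals are equal
    ([orbit_basis], [gr_ideal_indep]). On the other hand, the monomials in the
    theorem are at most as many as the covectors. So it remains to bound their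
    number, to check that the generators of the combinatorial ideal are top forms of
    vanishing polynomials, and to show that the monomials span.

    Counting ([NBC_card]). A conditional oriented matroid has at most as many NBC
    sets as topes. An NBC set is shattered by the topes, and more precisely order
    shattered ([NBC_order_shattered]); with [n] the largest element, both topes and
    order shattered sets split according to the deletion and the contraction of [n]
    ([card_order_shattered]). Every covector is a tope of the contraction by its
    flat, so summing over flats bounds the number of monomials by the number of
    covectors ([big_index_size]).

    Top forms ([hat_sub_gr]). Each generator is the leading form of an evident
    function vanishing on the locus. For a symmetric circuit both the product of the
    shifted variables [t_i] and the product of the [1 - t_i] vanish on the
    covectors of the contraction, and their combination with cancelling top terms
    leads with the elementary symmetric polynomial ([gr_ideal_elem_sym]). The
    difference of the monomials of two basic sets is homogeneous because basic sets
    of a flat are equinumerous, which is a matroid exchange argument below that flat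
    ([basic_card]).

    Spanning ([monomial_span], [flat_span]). The relation of a symmetric circuit
    rewrites a broken circuit into squarefree monomials that are smaller for the
    order, and a circuit kills its monomial. For the big locus this is carried out
    after multiplication by the monomial of a flat [F], by induction from large
    flats to small ones: multiplying further by some [z_i] lands in larger flats, so
    the [z_i] can be disregarded and the relations of the contraction remain.

    The same argument applied to the small locus of each contraction gives its NBC
    basis ([small_basis]). The graded isomorphism matches the two homogeneous bases,
    whose degrees differ by the size of the chosen basic set ([graded_iso_basis]). *)

(** * Covectors, closures and basic sets *)

Section Covectors.
Variables (I : finType) (M : {set signed I}).
Hypothesis M_COM : is_COM M.
Implicit Types (X Y Z W P : signed I) (B F G N A C D : {set I}).

Definition set_sign P (i : I) (s : option bool) : signed I :=
  [ffun j => if j == i then s else P j].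

Lemma scomp_fixP P Y :
  reflect (forall i, P i != None -> Y i = P i) (scomp P Y == Y).
Proof.
apply: (iffP eqP) => [<- i Pi|PY]; first by rewrite ffunE Pi.
by apply/ffunP=> i; rewrite ffunE; case: ifP => // /PY ->.
Qed.

Lemma flat_ofP F Y : reflect {in F, forall i, Y i = None} (F \subset flat_of Y).
Proof.
apply: (iffP subsetP) => FY i iF; last by rewrite inE FY.
by have := FY i iF; rewrite inE => /eqP.
Qed.

Lemma scomp_opp_mem X Y : X \in M -> Y \in M -> scomp X (sopp Y) \in M.
Proof. by case: M_COM => fs _; exact: fs. Qed.

(** Applying face symmetry twice gives closure under composition, because
    [X o -(X o -Y) = X o Y]. *)
Lemma scomp_mem X Y : X \in M -> Y \in M -> scomp X Y \in M.
Proof.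
move=> XM YM; have := scomp_opp_mem XM (scomp_opp_mem XM YM).
congr (_ \in M); apply/ffunP=> i; rewrite !ffunE.
by case: (X i) => [[]|] //=; case: (Y i) => [[]|].
Qed.

(** Strong elimination in the form used below: a coordinate [j] where the two
    signs are not opposite, or where [X] vanishes, lies outside the separator. *)
Lemma elimination X Y i : X \in M -> Y \in M -> X i != None ->
  Y i = sign_opp (X i) ->
  exists2 Z, Z \in M & Z i = None /\
    forall j, Y j != sign_opp (X j) \/ X j = None -> Z j = scomp X Y j.
Proof.
move=> XM YM Xi Yi; case: M_COM => _ se.
have iS : i \in sep X Y.
  by rewrite inE Xi Yi andbT; case: (X i) => [[]|].
have [Z ZM [Zi Zj]] := se X Y i XM YM iS; exists Z => //; split=> // j jS.
apply: Zj; rewrite inE; case: jS => [|->]; last by rewrite andbF.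
by case: (X j) => [[]|]; case: (Y j) => [[]|].
Qed.

Lemma flats_capI F G : F \in flats M -> G \in flats M -> F :&: G \in flats M.
Proof.
move=> /imsetP[X XM ->] /imsetP[Y YM ->]; apply/imsetP.
exists (scomp X Y); first exact: scomp_mem.
by apply/setP=> i; rewrite !inE ffunE; case: (X i).
Qed.

Lemma closure_isP C F :
  reflect [/\ F \in flats M, C \subset F &
             forall G, G \in flats M -> C \subset G -> F \subset G]
          (closure_is M C F).
Proof.
apply: (iffP minsetP) => [[/andP[FM CF] Fmin]|[FM CF Fmin]]; split=> //.
- move=> G GM CG; apply/setIidPl; apply: Fmin; last exact: subsetIl.
  by rewrite flats_capI // subsetI CF.
- by rewrite FM.
- by move=> G /andP[GM CG] GF; apply/eqP; rewrite eqEsubset GF Fmin.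
Qed.

Lemma closure_exists C G : G \in flats M -> C \subset G ->
  exists F, closure_is M C F.
Proof.
move=> GM CG.
have [|F FP _] := @minset_exists _ (fun G => (G \in flats M) && (C \subset G)) G.
  by rewrite GM.
by exists F.
Qed.

Lemma basicP F B :
  reflect [/\ F \in flats M, B \subset F,
      forall G, G \in flats M -> B \subset G -> F \subset G &
      forall b, b \in B -> ~~ closure_is M (B :\ b) F]
   (basic M F B).
Proof.
apply: (iffP and3P) => [[BF /closure_isP[FM _ Fmin] /forallP Bmin]|].
  split=> // b bB; apply/negP => cl; have := Bmin (B :\ b).
  by rewrite subD1set cl => /eqP BE; have := bB; rewrite -BE !inE eqxx.
case=> FM BF Fmin Bmin; split=> //; first exact/closure_isP.
apply/forallP=> C; apply/implyP=> /andP[CB clC]; rewrite eqEsubset CB.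
apply/subsetP=> b bB; apply: contraT => bC; case/negP: (Bmin b bB).
case/closure_isP: clC => _ CF Cmin; apply/closure_isP; split=> //.
  exact: subset_trans (subD1set _ _) BF.
move=> G GM BG; apply: Cmin => //; apply: subset_trans BG.
by apply/subsetD1P.
Qed.

(** Unlike [closure_is], this relation makes sense for every [C]; when [C] lies
    in a flat it is membership in the closure of [C] (see [closure_spanP]). *)
Definition in_closure C i := [forall Y in M, (C \subset flat_of Y) ==> (Y i == None)].

Lemma in_closureP C i :
  reflect (forall Y, Y \in M -> {in C, forall j, Y j = None} -> Y i = None)
    (in_closure C i).
Proof.
apply: (iffP forall_inP) => H Y YM.
  by move=> /flat_ofP YC; apply/eqP; exact: (implyP (H Y YM)).
by apply/implyP=> /flat_ofP/(H Y YM)->.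
Qed.

(** The exchange axiom of a matroid holds below each flat [F]. Take [W] witnessing
    that [i] is not in the closure of [C] and suppose that [Y] witnesses that [j]
    is not in the closure of [C] and [i]. Both are nonzero at [j]; composing with a
    covector of flat [F] allows [Y] to be negated on [F], so their signs at [j] may
    be taken opposite. Eliminating [j] yields a covector vanishing on [C] and [j]
    that agrees with [W] at [i], a contradiction. *)
Lemma closure_exchange F C i j : F \in flats M -> j \in F -> C \subset F ->
  i \in F -> ~~ in_closure C i -> in_closure (j |: C) i -> in_closure (i |: C) j.
Proof.
move=> /imsetP[X XM FE] jF CF iF; rewrite negb_forall_in => /exists_inP[W WM].
rewrite negb_imply => /andP[/flat_ofP WC Wi] /in_closureP ji.
apply/in_closureP=> Y YM YC; apply/eqP; apply: contraT => Yj.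
have X0 k : k \in F -> X k = None by rewrite FE inE => /eqP.
have Wj : W j != None.
  apply: contra Wi => /eqP Wj; apply/eqP; apply: ji => // k.
  by rewrite !inE => /predU1P[->|/WC].
have [Y' Y'M [Y'j Y'C]] : exists2 Y', Y' \in M &
    Y' j = sign_opp (W j) /\ {in i |: C, forall k, Y' k = None}.
  have [YW|YW] := eqVneq (Y j) (sign_opp (W j)); first by exists Y.
  exists (scomp X (sopp Y)); first exact: scomp_opp_mem.
  split=> [|k kC]; rewrite !ffunE X0 //=.
  - by case: (Y j) Yj YW => [[]|] //=; case: (W j) Wj => [[]|].
  - by rewrite YC.
  - by case/setU1P: kC => [->//|/(subsetP CF)].
have [Z ZM [Zj ZE]] := elimination WM Y'M Wj Y'j.
have Zi : Z i = W i.
  by rewrite ZE ?ffunE ?Wi // Y'C ?setU11 //; left; case: (W i) Wi => [[]|].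
suff : Z i = None by move=> Zi0; rewrite -Zi Zi0 in Wi.
apply: ji => // k /setU1P[->//|kC]; rewrite ZE ?ffunE ?WC ?Y'C ?inE ?kC ?orbT //.
by right.
Qed.

Lemma in_closure_mem C i : i \in C -> in_closure C i.
Proof. by move=> iC; apply/in_closureP=> Y _; apply. Qed.

Lemma in_closure_trans C D i : {in C, forall j, in_closure D j} -> in_closure C i -> in_closure D i.
Proof.
move=> CD /in_closureP Ci; apply/in_closureP=> Y YM YD; apply: Ci => // j /CD /in_closureP.
exact.
Qed.

Lemma closure_spanP C F : F \in flats M -> C \subset F ->
  reflect {in F, forall i, in_closure C i} (closure_is M C F).
Proof.
move=> FM CF; apply: (iffP idP) => [/closure_isP[_ _ Fmin] i iF|H].
  apply/in_closureP=> Y YM /flat_ofP CY; have /flat_ofP := Fmin _ (imset_f _ YM) CY.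
  exact.
apply/closure_isP; split=> // G /imsetP[Y YM ->] /flat_ofP CY.
by apply/flat_ofP => i /H /in_closureP; exact.
Qed.

(** Basic sets are the bases of the closure operator on [F]: spanning and
    independent. *)
Lemma basic_indepP F B : F \in flats M -> B \subset F ->
  reflect ({in F, forall i, in_closure B i} /\ {in B, forall b, ~~ in_closure (B :\ b) b})
    (basic M F B).
Proof.
move=> FM BF; have DF b : B :\ b \subset F.
  exact: subset_trans (subD1set _ _) BF.
apply: (iffP idP) => [/basicP[_ _ Fmin Bmin]|[Bsp Bmin]].
  have Bsp : {in F, forall i, in_closure B i} by apply/closure_spanP=> //; apply/closure_isP.
  split=> // b bB; apply: contra (Bmin b bB) => cb; apply/closure_spanP => // i iF.
  apply: in_closure_trans (Bsp i iF) => k kB.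
  by have [->//|kb] := eqVneq k b; apply: in_closure_mem; rewrite !inE kb.
apply/basicP; split=> //; first by case/(closure_spanP FM BF)/closure_isP: Bsp.
move=> b bB; apply: contra (Bmin b bB) => /(closure_spanP FM (DF b)).
by apply; exact: (subsetP BF).
Qed.

(** The usual basis exchange: while [B] is not inside [B'], trade an element of
    [B] outside [B'] for one of [B'], keeping the cardinality. Homogeneity of the
    relations between basic sets of a flat rests on this. *)
Lemma basic_card F B B' : basic M F B -> basic M F B' -> #|B| = #|B'|.
Proof.
move=> bB bB'; have [k] := ubnP #|B :\: B'|.
elim: k => // m IHm in B bB * => Bk; have [BB'|] := eqVneq (B :\: B') set0.
  case/and3P: bB => _ cl _; case/and3P: bB' => _ _ /forallP/(_ B).
  have -> : B \subset B' by rewrite -setD_eq0 BB'.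
  by rewrite cl => /eqP ->.
case/set0Pn=> b /setDP[bB0 bB'0].
have [FM BF _ _] := basicP _ _ bB; have [_ BF' _ _] := basicP _ _ bB'.
have [Bsp Bmin] := basic_indepP FM BF bB.
have [Bsp' Bmin'] := basic_indepP FM BF' bB'.
(* Otherwise the closure of [B :\ b] would contain [B'], hence all of [F]. *)
have [b' b'B nb'] : exists2 b', b' \in B' & ~~ in_closure (B :\ b) b'.
  apply/exists_inP; rewrite -negb_forall_in; apply: contra (Bmin b bB0).
  move=> /forall_inP H; apply: in_closure_trans (Bsp' b (subsetP BF b bB0)).
  by move=> j /H.
have BE : b |: (B :\ b) = B by rewrite setD1K.
have DF : B :\ b \subset F := subset_trans (subD1set _ _) BF.
have b'F := subsetP BF' _ b'B; have bF := subsetP BF _ bB0.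
have bcl : in_closure (b' |: (B :\ b)) b.
  by apply: (@closure_exchange F) => //; rewrite BE Bsp.
have b'N : b' \notin B :\ b by apply: contra nb' => /in_closure_mem.
have b'nB : b' \notin B.
  apply: contra b'N => b'B1; rewrite !inE b'B1 andbT.
  by apply: contraNneq bB'0 => <-.
have sub : b' |: (B :\ b) \subset F by rewrite subUset sub1set b'F.
have bB'' : basic M F (b' |: (B :\ b)).
  apply/basic_indepP => //; split=> [i iF|c].
    apply: in_closure_trans (Bsp i iF) => k kB; have [->//|kb] := eqVneq k b.
    by apply: in_closure_mem; rewrite !inE kb kB orbT.
  case/setU1P=> [->|cB]; first by rewrite setU1K.
  have cb' : c != b' by apply: contraNneq b'N => <-.
  have cb : c != b by case/setD1P: cB.
  have -> : (b' |: (B :\ b)) :\ c = b' |: (B :\ b :\ c).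
    apply/setP=> k; rewrite !inE; have [->|] := eqVneq k c => //=.
    by rewrite (negPf cb').
  (* Removing [c] from both sides of the exchange: were [c] redundant, [b'] would
     already be in the closure of [B :\ b]. *)
  apply: contra nb' => b'c; rewrite -(setD1K cB); apply: (@closure_exchange F) => //.
  - exact: subset_trans (subD1set _ _) DF.
  - exact: (subsetP DF).
  - have cB0 : c \in B by case/setD1P: cB.
    apply: contra (Bmin c cB0); apply: in_closure_trans => k.
    by rewrite !inE => /and3P[kc kb kB]; apply: in_closure_mem; rewrite !inE kc.
rewrite -(IHm _ bB''); first by rewrite cardsU1 b'N (cardsD1 b B) bB0.
rewrite -ltnS; apply: leq_trans Bk; rewrite ltnS; apply: proper_card.
apply/properP; split.
  apply/subsetP=> k; rewrite !inE => /andP[kB' /orP[/eqP kb|/andP[_ ->]]].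
    by rewrite kb b'B in kB'.
  by rewrite kB'.
by exists b; rewrite !inE ?bB0 ?bB'0 // eqxx /= orbF; apply: contraNneq bB'0 => ->.
Qed.

Lemma codimE F B : basic M F B -> codim M F = #|B|.
Proof.
rewrite /codim; case: pickP => [B' bB' bB|/(_ B) -> //]; exact: basic_card bB' bB.
Qed.

(** The sign pattern [P] occurs in the minor obtained by contracting [F] and
    restricting to the support of [P]. All minors are described on the ground set
    [I] in this way, so that inductions over minors do not change the type. *)
Definition extendable F P := [exists Y in M, (F \subset flat_of Y) && (scomp P Y == Y)].

Lemma extendableP F P :
  reflect (exists2 Y, Y \in M & {in F, forall i, Y i = None} /\
            forall i, P i != None -> Y i = P i) (extendable F P).
Proof.
apply: (iffP exists_inP) => [[Y YM /andP[/flat_ofP YF /scomp_fixP YP]]|[Y YM [YF YP]]];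
  exists Y => //; apply/andP; split; [exact/flat_ofP|exact/scomp_fixP].
Qed.

Definition shattered F N := [forall P, (supp P \subset N) ==> extendable F P].

Lemma shatteredP F N :
  reflect (forall P, supp P \subset N -> extendable F P) (shattered F N).
Proof. exact: forall_inP. Qed.

Lemma supp_set_sign P i s : supp (set_sign P i (Some s)) = i |: supp P.
Proof. by apply/setP=> j; rewrite !inE ffunE; case: (j == i). Qed.

(** Eliminating [n] between the two extensions. *)
Lemma extendable_contract F P n : P n = None ->
  extendable F (set_sign P n (Some true)) ->
  extendable F (set_sign P n (Some false)) -> extendable (n |: F) P.
Proof.
move=> Pn /extendableP[Y YM [YF YP]] /extendableP[Y' YM' [YF' YP']].
have Yn : Y n = Some true by rewrite YP ffunE eqxx.
have Yn' : Y' n = Some false by rewrite YP' ffunE eqxx.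
have [||Z ZM [Zn ZE]] := @elimination Y Y' n YM YM'; rewrite ?Yn ?Yn' //.
have E j : P j != None -> Y j = P j /\ Y' j = P j.
  move=> Pj; have jn : j != n by apply: contraNneq Pj => ->; rewrite Pn.
  by split; [rewrite YP|rewrite YP']; rewrite ffunE (negPf jn).
apply/extendableP; exists Z => //; split=> [j /setU1P[->//|jF]|j Pj].
  by rewrite ZE ?ffunE ?YF ?YF' //; right.
have [Yj Yj'] := E j Pj.
rewrite ZE ?ffunE Yj ?Yj' ?Pj //; left; by case: (P j) Pj => [[]|].
Qed.

(** Shattering only asks for covectors above [P]; the zeros of [P] on [D] can be
    realised too, by eliminating them one at a time between a covector that is
    positive and one that is negative there. *)
Lemma shattered_exact D P : shattered set0 D -> supp P \subset D ->
  exists2 Y, Y \in M & {in D, forall j, Y j = P j}.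
Proof.
move=> /shatteredP shD; have [k] := ubnP #|D :\: supp P|.
elim: k => // k IHk in P * => Pk PD.
have [D0|/set0Pn[j /setDP[jD]]] := eqVneq (D :\: supp P) set0.
  have /extendableP[Y YM [_ YP]] := shD P PD; exists Y => // j jD.
  apply: YP; have : j \in supp P by apply: contraT => jP; rewrite -(in_set0 j) -D0 inE jP.
  by rewrite inE.
rewrite inE negbK => /eqP Pj.
have H s : exists2 Y, Y \in M & {in D, forall i, Y i = set_sign P j (Some s) i}.
  apply: IHk; last by rewrite supp_set_sign subUset sub1set jD.
  rewrite -ltnS; apply: leq_trans Pk; rewrite ltnS supp_set_sign; apply: proper_card.
  apply/properP; split; first by rewrite setDS // subsetUr.
  by exists j; rewrite !inE ?eqxx ?Pj ?jD.
have [Y YM YE] := H true; have [Y' YM' YE'] := H false.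
have Yj : Y j = Some true by rewrite YE // ffunE eqxx.
have Yj' : Y' j = Some false by rewrite YE' // ffunE eqxx.
have [||Z ZM [Zj ZE]] := @elimination Y Y' j YM YM'; rewrite ?Yj ?Yj' //.
exists Z => // i iD; have [->|ij] := eqVneq i j; first by rewrite Zj.
rewrite ZE ?ffunE ?YE ?YE' ?ffunE ?(negPf ij) //; first by case: (P i).
by case: (P i) => [[]|]; [left|left|right].
Qed.

Section Count.
Variable le : rel I.
Hypothesis le_order : total_order le.

Definition above i N := [set j in N | ~~ le j i].

(** The form of the no broken circuit condition that passes to the deletion and the
    contraction of the largest element. For a shattered set [N] and [i] outside [N],
    the minor contracted by [F] has a symmetric circuit with least element [i] and
    its other elements in [N] exactly when [i] lies in the closure of [F] and the
    elements of [N] above [i]. *)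
Definition order_shattered F A N := shattered F N &&
  [forall i in A :\: N, [exists W in M, (F :|: above i N \subset flat_of W) &&
      (W i != None)]].

Lemma exists_max A : A != set0 -> exists2 n, n \in A & {in A, forall i, le i n}.
Proof.
case: le_order => tot tr _.
have [k] := ubnP #|A|; elim: k => // k IHk in A * => Ak /set0Pn[a aA].
have [A0|A0] := eqVneq (A :\ a) set0.
  exists a => // i iA; have [->|ia] := eqVneq i a; first by have := tot a a; rewrite orbb.
  by have := in_set0 i; rewrite -A0 !inE ia iA.
have [|n] := IHk (A :\ a) _ A0; first by rewrite (cardsD1 a A) aA in Ak.
rewrite !inE => /andP[na nA] Hn.
have [an|an] := boolP (le a n).
  by exists n => // i iA; have [->//|ia] := eqVneq i a; apply: Hn; rewrite !inE ia.
have na' : le n a by have := tot a n; rewrite (negPf an).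
exists a => // i iA; have [->|ia] := eqVneq i a; first by have := tot a a; rewrite orbb.
by apply: tr na'; apply: Hn; rewrite !inE ia.
Qed.

(** Let [n] be the largest element of [A] and [A' = A :\ n]. Topes on [A] split by
    their sign at [n] into two families of topes on [A']; the union of these
    families contains the topes of the deletion of [n], and their intersection those
    of the contraction of [n]. Sets [N] split in the same way: those without [n] are
    order shattered in the deletion, and those with [n] become order shattered in the
    contraction after [n] is removed. Hence the bound follows by induction. *)
Lemma card_order_shattered A F :
  #|[set N : {set I} | (N \subset A) && order_shattered F A N]|
    <= #|[set P | (supp P == A) && extendable F P]|.
Proof.
have [k] := ubnP #|A|; elim: k => // k IHk in A F * => Ak.
have [->|A0] := eqVneq A set0.
  set L := [set N : {set I} | _]; have [L0|/set0Pn[N]] := eqVneq L set0; first by rewrite L0 cards0.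
  rewrite inE subset0 => /andP[/eqP-> /andP[/shatteredP sh _]].
  have LE : L \subset [set set0] by apply/subsetP=> N'; rewrite !inE subset0 => /andP[].
  apply: leq_trans (subset_leq_card LE) _; rewrite cards1 card_gt0.
  apply/set0Pn; exists [ffun => None]; rewrite inE.
  have E : supp [ffun => None : option bool] = set0 :> {set I}.
    by apply/setP=> i; rewrite !inE ffunE.
  by rewrite E eqxx sh // E.
have [n nA nmax] := exists_max A0; pose A' := A :\ n.
have AE : n |: A' = A by rewrite setD1K.
have nA' : n \notin A' by rewrite !inE eqxx.
have A'k : #|A'| < k by move: Ak; rewrite (cardsD1 n A) nA.
set L := [set N : {set I} | _]; set T := [set P : signed I | _].
have [/exists_inP[W WM /andP[/flat_ofP WF Wn]]|loop] :=
   boolP [exists W in M, (F \subset flat_of W) && (W n != None)]; last first.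
  (* If all covectors vanish at [n], neither shattering (when [n] is in [N]) nor
     the second condition (when it is not) can hold. *)
  suff -> : L = set0 by rewrite cards0.
  apply/setP=> N; rewrite !inE; apply/negP=> /andP[NA /andP[/shatteredP sh /forall_inP G]].
  case/negP: loop; have [nN|nN] := boolP (n \in N).
    pose P : signed I := set_sign [ffun=> None] n (Some true).
    have /sh/extendableP[Y YM [YF YP]] : supp P \subset N.
      rewrite supp_set_sign; apply/subsetP=> i; rewrite !inE ffunE eqxx orbF.
      by move=> /eqP->.
    apply/exists_inP; exists Y => //; rewrite YP ffunE eqxx ?andbT //=.
    exact/flat_ofP.
  have /G/exists_inP[W WM /andP[/flat_ofP WF Wn]] : n \in A :\: N by rewrite inE nN.
  apply/exists_inP; exists W => //; rewrite Wn andbT; apply/flat_ofP=> i iF.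
  by apply: WF; rewrite inE iF.
(* The topes with sign [s] at [n], seen on [A']. *)
pose U s := [set P : signed I | (supp P == A') && extendable F (set_sign P n (Some s))].
have Pn P : supp P == A' -> P n = None.
  by move=> /eqP PA; apply/eqP; apply: contraT => Pn; case/negP: nA'; rewrite -PA inE.
have TU : #|U true| + #|U false| <= #|T|.
  have inj s : {in U s &, injective (fun P => set_sign P n (Some s))}.
    move=> P P'; rewrite !inE => /andP[/Pn Pn1 _] /andP[/Pn Pn2 _] E.
    apply/ffunP=> i; have := congr1 (fun f : signed I => f i) E; rewrite !ffunE.
    by case: eqP => // ->; rewrite Pn1 Pn2.
  rewrite -(card_in_imset (inj true)) -(card_in_imset (inj false)) -cardsUI.
  have -> : [set set_sign P n (Some true) | P in U true] :&:
            [set set_sign P n (Some false) | P in U false] = set0.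
    apply/setP=> Q; rewrite !inE; apply/negP=> /andP[/imsetP[P _ ->] /imsetP[P' _ E]].
    by have := congr1 (fun f : signed I => f n) E; rewrite !ffunE eqxx.
  rewrite cards0 addn0; apply: subset_leq_card; rewrite subUset.
  apply/andP; split; apply/subsetP=> _ /imsetP[P PU ->]; move: PU;
  by rewrite !inE supp_set_sign => /andP[/eqP-> ->]; rewrite AE eqxx.
apply: leq_trans TU; rewrite -cardsUI.
pose L1 := [set N : {set I} | (N \subset A') && order_shattered F A' N].
pose L2 := [set N : {set I} | (N \subset A') && order_shattered (n |: F) A' N].
have LL : #|L| <= #|L1| + #|L2|.
  have L2i : {in L2 &, injective (fun N : {set I} => n |: N)}.
    move=> N N'; rewrite !inE => /andP[NA _] /andP[NA' _] E.
    have nU (D : {set I}) : D \subset A' -> n \notin D.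
      by move=> DA; apply: contra nA'; exact: (subsetP DA).
    by rewrite -(setU1K (nU _ NA)) E setU1K // nU.
  rewrite -(card_in_imset L2i); apply: leq_trans (leq_card_setU _ _).
  apply: subset_leq_card; apply/subsetP=> N; rewrite !inE.
  move=> /andP[NA /andP[/shatteredP sh /forall_inP G]].
  have [nN|nN] := boolP (n \in N); last first.
    apply/orP; left; rewrite subsetD1 NA nN /=; apply/andP; split.
      exact/shatteredP.
    by apply/forall_inP=> i; rewrite !inE => /and3P[iN _ iA]; apply: G; rewrite inE iN.
  apply/orP; right; apply/imsetP; exists (N :\ n); last by rewrite setD1K.
  rewrite inE setSD //=; apply/andP; split.
    apply/shatteredP=> P /subsetD1P[PN nP]; apply: extendable_contract.
    - by apply/eqP; move: nP; rewrite inE negbK.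
    - by apply: sh; rewrite supp_set_sign subUset sub1set nN.
    - by apply: sh; rewrite supp_set_sign subUset sub1set nN.
  apply/forall_inP=> i; rewrite !inE => /and3P[].
  rewrite negb_and negbK => /orP[/eqP->|iN]; rewrite ?eqxx // => in' iA.
  have /G/exists_inP[W' WM' /andP[/flat_ofP WF' Wi]] : i \in A :\: N by rewrite inE iN.
  apply/exists_inP; exists W' => //; rewrite Wi andbT; apply/flat_ofP => j.
  have ni : ~~ le n i.
    apply: contra in' => ni; case: le_order => _ _ anti; apply/eqP; apply: anti.
    by rewrite ni nmax.
  rewrite !inE => H; apply: WF'; rewrite !inE; case: (j \in F) H => //=.
  have [->|jn] := eqVneq j n; by rewrite ?nN ?ni ?orbF.
apply: (leq_trans LL); apply: leq_add.
  apply: leq_trans (IHk _ _ A'k) _; apply: subset_leq_card; apply/subsetP=> P.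
  rewrite !inE => /andP[PA /extendableP[Y YM [YF YP]]]; rewrite PA /=.
  have : extendable F (set_sign P n (scomp Y W n)).
    apply/extendableP; exists (scomp Y W); first exact: scomp_mem.
    split=> [i iF|i]; first by rewrite ffunE YF ?WF.
    rewrite [set_sign _ _ _ i]ffunE; case: (i =P n) => [->//|_ Pi].
    by rewrite ffunE YP // Pi.
  have : scomp Y W n != None by rewrite ffunE; case: ifP.
  by case: (scomp Y W n) => [[]|] // _ ->; rewrite ?orbT.
apply: leq_trans (IHk _ _ A'k) _; apply: subset_leq_card; apply/subsetP=> P.
rewrite !inE => /andP[PA /extendableP[Y YM [YF YP]]]; rewrite PA /=.
have Yn : Y n = None by rewrite YF ?setU11.
(* The two signs at [n] come from composing with [W] and with the negative of [W]. *)
have H s (W' : signed I) : W' \in M -> {in F, forall i, W' i = None} ->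
    W' n = Some s -> extendable F (set_sign P n (Some s)).
  move=> WM' WF' Wn'; apply/extendableP; exists (scomp Y W'); first exact: scomp_mem.
  split=> [i iF|i]; first by rewrite ffunE YF ?setU1r ?WF'.
  rewrite !ffunE; case: (i =P n) => [->|_ Pi]; first by rewrite Yn Wn'.
  by rewrite YP // Pi.
have WM' := scomp_opp_mem YM WM.
have WF' : {in F, forall i, scomp Y (sopp W) i = None}.
  by move=> i iF; rewrite !ffunE YF ?setU1r ?WF.
case En: (W n) Wn => [s|] // _.
have En' : scomp Y (sopp W) n = Some (~~ s) by rewrite !ffunE Yn En.
by case: s En En' => En En'; rewrite (H _ _ WM WF En) (H _ _ WM' WF' En').
Qed.

(** A circuit is a minimal sign pattern that extends to no covector. *)
Lemma circuit_below P : ~~ extendable set0 P ->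
  exists2 X, circuit M X & supp X \subset supp P /\ forall i, X i != None -> X i = P i.
Proof.
have [k] := ubnP #|supp P|; elim: k => // k IHk in P * => Pk nP.
have nP' : [forall Y in M, scomp P Y != Y].
  apply/forall_inP=> Y YM; apply: contra nP => PY; apply/exists_inP.
  by exists Y; rewrite ?PY ?sub0set.
have [cP|] := boolP (circuit M P); first by exists P.
rewrite negb_and nP' /= => /forallPn[Z]; rewrite negb_imply.
move=> /andP[/andP[ZP /forallP Zle] nZ].
have ZPE i : Z i != None -> Z i = P i.
  by move=> Zi; have := Zle i; rewrite (negPf Zi) => /eqP.
have ZS : supp Z \subset supp P.
  by apply/subsetP=> i; rewrite !inE => Zi; rewrite -ZPE.
have Zk : #|supp Z| < k.
  rewrite -ltnS; apply: leq_trans Pk; rewrite ltnS; apply: proper_card.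
  rewrite properEneq ZS andbT; apply: contra ZP => /eqP SE; apply/eqP/ffunP=> i.
  have [Zi|/ZPE//] := eqVneq (Z i) None.
  have : i \notin supp P by rewrite -SE inE Zi.
  by rewrite inE negbK Zi => /eqP.
have [|X cX [XS XE]] := IHk Z Zk.
  apply: contra nZ => /extendableP[Y YM [_ YZ]]; apply/exists_inP; exists Y => //.
  exact/scomp_fixP.
exists X => //; split=> [|i Xi]; first exact: subset_trans XS ZS.
by rewrite XE // ZPE // -XE.
Qed.

(** A pattern on [N] that does not extend contains a circuit supported in [N], so [N]
    is shattered. Now let [i] be outside [N], let [D] be the set of elements of [N]
    above [i], and suppose that every covector vanishing on [D] vanishes at [i].
    Some covector [W] vanishes on [i |: D], so restriction to [i |: D] is closed
    under negation (through [W o -Y]) and every circuit in [i |: D] is symmetric. As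
    [i |: D] is not shattered it contains a circuit; dropping its least element [i]
    leaves a broken circuit inside [N]. *)
Lemma NBC_order_shattered N : N \in NBC M le -> order_shattered set0 setT N.
Proof.
rewrite inE => /andP[/forall_inP nc /forall_inP nsc].
have sh (D : {set I}) : D \subset N -> shattered set0 D.
  move=> DN; apply/shatteredP => P PN; apply: contraT => /circuit_below[X cX [XP _]].
  case/negP: (nc X cX); apply: subset_trans DN; exact: subset_trans XP PN.
apply/andP; split; first exact: sh.
apply/forall_inP=> i; rewrite !inE andbT => iN; rewrite set0U.
apply: contraT; rewrite negb_exists_in => /forall_inP noW.
set D := above i N; have DN : D \subset N by apply/subsetP=> j; rewrite inE => /andP[].
have shD := sh D DN.
have W0 W : W \in M -> {in D, forall j, W j = None} -> W i = None.
  by move=> WM /flat_ofP WD; have := noW W WM; rewrite WD negbK => /eqP.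
have iD : i \notin D by apply: contra iN => /(subsetP DN).
have [W WM WD] : exists2 W, W \in M & {in D, forall j, W j = None}.
  have [|W WM WE] := @shattered_exact D [ffun => None] shD.
    by apply/subsetP=> j; rewrite inE ffunE.
  by exists W => // j jD; rewrite WE ?ffunE.
have Wi := W0 W WM WD.
have [P PD nP] : exists2 P, supp P \subset i |: D & ~~ extendable set0 P.
  apply/exists_inP; apply: contraT; rewrite negb_exists_in => /forall_inP H.
  have shiD : shattered set0 (i |: D).
    by apply/shatteredP => P /H; rewrite negbK.
  have [|Y YM YE] := @shattered_exact (i |: D) (set_sign [ffun => None] i (Some true)) shiD.
    by rewrite supp_set_sign setUS //; apply/subsetP=> j; rewrite inE ffunE.
  have Yi : Y i = Some true by rewrite YE ?setU11 // ffunE eqxx.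
  suff : Y i = None by rewrite Yi.
  apply: W0 => // j jD.
  rewrite YE ?setU1r // !ffunE; case: (j =P i) => // ji; by rewrite -ji jD in iD.
have [X cX [XP _]] := circuit_below nP.
have XD : supp X \subset i |: D := subset_trans XP PD.
have WX j : X j != None -> W j = None.
  move=> Xj; have : j \in i |: D by apply: (subsetP XD); rewrite inE.
  by case/setU1P=> [->|/WD].
(* Negation of covectors on the zero set of [W]. *)
have neg Z : (forall j, Z j != None -> W j = None) ->
    (exists2 Y, Y \in M & scomp (sopp Z) Y == Y) ->
    exists2 Y, Y \in M & scomp Z Y == Y.
  move=> WZ [Y YM /scomp_fixP YZ]; exists (scomp W (sopp Y)); first exact: scomp_opp_mem.
  apply/scomp_fixP=> j Zj; rewrite !ffunE WZ //= YZ ?ffunE; last by case: (Z j) Zj.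
  by case: (Z j) => [[]|].
have soppK Z : sopp (sopp Z) = Z.
  by apply/ffunP=> j; rewrite !ffunE; case: (Z j) => [[]|].
have [/forall_inP cX1 /forallP cX2] := andP cX.
have cNX : circuit M (sopp X).
  apply/andP; split.
    apply/forall_inP=> Y YM; apply/negP=> YX; have [|Y' YM' YX'] := neg X WX.
      by exists Y.
    by have := cX1 _ YM'; rewrite YX'.
  apply/forallP=> Z; apply/implyP=> /andP[ZX /forallP Zle].
  have Zle' j : (Z j == None) || (Z j == sign_opp (X j)).
    by have := Zle j; rewrite ffunE.
  apply/exists_inP; apply: neg.
    move=> j Zj; apply: WX; have := Zle' j; rewrite (negPf Zj) /= => /eqP E.
    by apply: contra Zj => /eqP Xj; rewrite E Xj.
  apply/exists_inP; apply: (implyP (cX2 _)); apply/andP; split.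
    by apply: contra ZX => /eqP <-; rewrite soppK.
  apply/forallP=> j; rewrite ffunE; have := Zle' j.
  by case: (Z j) => [[]|] //=; case: (X j) => [[]|].
have /nsc/negP[] : symmetric_circuit M X by rewrite /symmetric_circuit cX.
case: (le_order) => tot _ anti.
apply/subsetP=> j; rewrite inE => /andP[jX]; apply: contraR => jN.
have /setU1P[->|jD] := subsetP XD j jX; last by rewrite (subsetP DN) in jN.
apply/forall_inP=> k kX; have /setU1P[->|] := subsetP XD k kX.
  by have := tot i i; rewrite orbb.
by rewrite inE => /andP[_ ki]; have := tot i k; rewrite (negPf ki) orbF.
Qed.

Lemma NBC_card : #|NBC M le| <= #|topes M|.
Proof.
apply: (@leq_trans #|[set N : {set I} | (N \subset setT) && order_shattered set0 setT N]|).
  by apply: subset_leq_card; apply/subsetP=> N /NBC_order_shattered; rewrite inE subsetT.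
apply: leq_trans (card_order_shattered _ _) _; apply: subset_leq_card; apply/subsetP=> P.
rewrite !inE => /andP[/eqP PT /extendableP[Y YM [_ YP]]].
have P0 i : P i != None by have := in_setT i; rewrite -PT inE.
have -> : P = Y by apply/ffunP=> i; rewrite YP.
by rewrite YM; apply/forallP => i; rewrite YP.
Qed.

End Count.
End Covectors.

(** * Contractions *)

Section Contraction.
Variables (I : finType) (M : {set signed I}).
Hypothesis M_COM : is_COM M.
Implicit Types (F : {set I}).

Lemma contractionP F (Y : signed {i : I | i \notin F}) :
  reflect (exists2 X, X \in M & {in F, forall i, X i = None} /\ Y = restrict F X)
    (Y \in contraction M F).
Proof.
apply: (iffP imsetP) => [[X]|[X XM [/flat_ofP XF ->]]].
  by rewrite inE => /andP[XM /flat_ofP XF] ->; exists X.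
by exists X; rewrite // inE XM.
Qed.

Lemma contraction_COM F : is_COM (contraction M F).
Proof.
split=> [X Y /contractionP[X' XM [XF ->]] /contractionP[Y' YM [YF ->]]|].
  apply/contractionP; exists (scomp X' (sopp Y')); first exact: scomp_opp_mem.
  split=> [i iF|]; first by rewrite !ffunE XF ?YF.
  by apply/ffunP=> i; rewrite !ffunE.
move=> X Y i /contractionP[X' XM [XF ->]] /contractionP[Y' YM [YF ->]].
rewrite inE !ffunE => iS; case: M_COM => _ se.
have [|Z ZM [Zi ZE]] := se X' Y' (val i) XM YM; first by rewrite inE.
exists (restrict F Z); last first.
  rewrite ffunE Zi; split=> // j jS; rewrite !ffunE ZE ?ffunE //.
  by apply: contra jS; rewrite !inE !ffunE.
apply/contractionP; exists Z => //; split=> // j jF.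
by rewrite ZE ?ffunE ?XF //= ?YF // inE XF // eqxx andbF.
Qed.

(** A tope of the contraction by [F] is the restriction of a covector whose flat is
    exactly [F]. *)
Lemma card_topes_contraction F :
  #|topes (contraction M F)| <= #|[set X in M | flat_of X == F]|.
Proof.
apply: leq_trans (leq_imset_card (restrict F) _); apply: subset_leq_card.
apply/subsetP=> Y; rewrite inE => /andP[/contractionP[X XM [XF ->]] /forallP Y0].
apply: imset_f; rewrite inE XM; apply/eqP/setP=> i; rewrite inE.
apply/eqP/idP => [Xi|/XF//]; apply: contraT => iF.
by have := Y0 (Sub i iF); rewrite ffunE Xi.
Qed.

Lemma sum_card_flats : \sum_(F in flats M) #|[set X in M | flat_of X == F]| = #|M|.
Proof.
rewrite -sum1_card (partition_big_imset (@flat_of I)) /=.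
by apply: eq_bigr => F _; rewrite -sum1_card; apply: eq_bigl => X; rewrite inE.
Qed.

End Contraction.

Local Open Scope ring_scope.

(** * Homogeneous bases of graded vector spaces *)

Section BasisFamily.
Variables (K : fieldType) (U : eqType) (L : seq U).

(** Bases indexed by a sequence of labels rather than listed, so that bases of
    different spaces can be compared through a common set of labels. *)
Definition basis_family (V : lmodType K) (b : U -> V) : Prop :=
  (forall v, exists c : U -> K, v = \sum_(u <- L) c u *: b u) /\
  (forall c : U -> K, \sum_(u <- L) c u *: b u = 0 -> {in L, forall u, c u = 0}).

Hypothesis uniq_index : uniq L.

Lemma is_basis_map (V : lmodType K) (b : U -> V) :
  basis_family b -> is_basis [seq b u | u <- L].
Proof.
case=> bsp bind; rewrite /is_basis.
have sumE (c : nat -> K) :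
    \sum_(i < size [seq b u | u <- L]) c i *: [seq b u | u <- L]`_i =
    \sum_(u <- L) c (index u L) *: b u.
  case E : L => [|u0 L']; first by rewrite big_nil big_ord0.
  rewrite -E (big_nth u0) big_mkord size_map; apply: eq_bigr => i _.
  by rewrite (nth_map u0) // index_uniq.
split=> [v|c c0 i].
  have [c ->] := bsp v.
  have [d dE] : exists d : nat -> K, {in L, forall u, d (index u L) = c u}.
    case E : L => [|u0 L']; first by exists (fun=> 0).
    by exists (fun i => c (nth u0 L i)) => u uL; rewrite -E nth_index // E.
  exists (fun i => d (val i)); rewrite (sumE d).
  by apply: eq_big_seq => u /dE ->.
pose d n := oapp c 0 (insub n).
have dE j : d (val j) = c j by rewrite /d valK.
have {}c0 : \sum_(u <- L) d (index u L) *: b u = 0.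
  by rewrite -sumE -[RHS]c0; apply: eq_bigr => j _; rewrite dE.
have iL : (i < size L)%N by rewrite -(size_map b).
have [u0 _] : exists u0, u0 \in L.
  move: (nat_of_ord i) iL => k kL.
  by case: (L) kL => // u0 L' _; exists u0; rewrite mem_head.
by have := bind _ c0 (nth u0 L i) (mem_nth _ iL); rewrite index_uniq // dE.
Qed.

End BasisFamily.

Section GradedIso.
Variables (K : fieldType) (U : eqType) (L : seq U) (dg : U -> nat).

(** Subtracting the vector from the sum of its homogeneous parts gives a relation
    between components of distinct degrees, so each part of the wrong degree is zero. *)
Lemma basis_piece (V : gradedModule K) (b : U -> V) d (c : U -> K) :
  basis_family L b -> {in L, forall u, b u \in gpiece V (dg u)} ->
  \sum_(u <- L) c u *: b u \in gpiece V d ->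
  {in L, forall u, dg u != d -> c u = 0}.
Proof.
move=> [_ bind] bd vd.
pose w e := \sum_(u <- L | dg u == e) c u *: b u -
            (if e == d then \sum_(u <- L) c u *: b u else 0).
pose N := (maxn d (\max_(u <- L) dg u)).+1.
have pieceD e x y : x \in gpiece V e -> y \in gpiece V e -> (forall a, a *: x + y \in gpiece V e).
  by case: (gpiece_submod V e) => _ H xe ye a; exact: H.
have dN u : u \in L -> (dg u < N)%N.
  by move=> uL; rewrite /N ltnS leq_max (@leq_bigmax_seq _ L predT) ?orbT.
have wd e : w e \in gpiece V e.
  rewrite /w addrC -scaleN1r; apply: (pieceD); first by case: eqP => [->|_]; rewrite ?gpiece0.
  rewrite big_seq_cond; elim/big_rec: _ => [|u x /andP[uL /eqP ue] xe]; first exact: gpiece0.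
  by apply: (pieceD) => //; rewrite -ue bd.
have w0 : \sum_(e < N) w e = 0.
  rewrite sumrB; apply/eqP; rewrite subr_eq0; apply/eqP.
  have dN' : (d < N)%N by rewrite ltnS leq_maxl.
  rewrite [RHS](bigD1 (Ordinal dN')) //= eqxx [X in _ = _ + X]big1 ?addr0; last first.
    by move=> e; rewrite -val_eqE /= => /negPf ->.
  rewrite (exchange_big_dep predT) //= big_seq [RHS]big_seq.
  apply: eq_bigr => u uL.
  rewrite (bigD1 (Ordinal (dN u uL))) //= big1 ?addr0 // => e /andP[/eqP E].
  by rewrite -val_eqE /= -E eqxx.
move=> u uL ud.
have := gpiece_direct wd w0 (dN u uL); rewrite /w (negPf ud) subr0.
rewrite big_mkcond => E.
have {}E : \sum_(v <- L) (if dg v == dg u then c v else 0) *: b v = 0.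
  by rewrite -[RHS]E; apply: eq_bigr => v _; case: ifP; rewrite ?scale0r.
by have := bind _ E u uL; rewrite eqxx.
Qed.

Lemma graded_iso_basis (V W : gradedModule K) (b : U -> V) (b' : U -> W) :
  basis_family L b -> basis_family L b' ->
  {in L, forall u, b u \in gpiece V (dg u)} ->
  {in L, forall u, b' u \in gpiece W (dg u)} -> graded_iso V W.
Proof.
move=> bb bb' bd bd'.
have coord (X : lmodType K) (a : U -> X) : basis_family L a ->
    {cf : X -> U -> K | forall v, v = \sum_(u <- L) cf v u *: a u}.
  case=> asp _; exists (fun v => projT1 (cid (asp v))) => v.
  by case: (cid (asp v)).
have [c cE] := coord _ _ bb; have [c' cE'] := coord _ _ bb'.
have uniqc (X : lmodType K) (a : U -> X) (e f : U -> K) : basis_family L a ->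
    \sum_(u <- L) e u *: a u = \sum_(u <- L) f u *: a u -> {in L, e =1 f}.
  move=> [_ aind] /eqP; rewrite -subr_eq0 -sumrB => /eqP E u uL.
  apply/eqP; rewrite -subr_eq0; apply/eqP.
  apply: (aind (fun u => e u - f u)) => //; rewrite -[RHS]E.
  by apply: eq_bigr => v _; rewrite scalerBl.
pose phi (v : V) : W := \sum_(u <- L) c v u *: b' u.
pose psi (w : W) : V := \sum_(u <- L) c' w u *: b u.
have phi_lin : linear phi.
  move=> a x y; rewrite /phi scaler_sumr -big_split /= big_seq [RHS]big_seq.
  apply: eq_bigr => u uL; rewrite scalerA -scalerDl; congr (_ *: _).
  apply: (uniqc _ _ (c (a *: x + y)) (fun u => a * c x u + c y u) bb) uL.
  rewrite -cE {1}(cE x) {1}(cE y) scaler_sumr -big_split /=.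
  by apply: eq_bigr => v _; rewrite scalerDl scalerA.
pose F : {linear V -> W} := HB.pack phi (GRing.isLinear.Build K V W _ phi phi_lin).
have phiK : cancel phi psi.
  move=> v; rewrite /psi [RHS]cE big_seq [RHS]big_seq; apply: eq_bigr => u uL.
  congr (_ *: _); apply: uniqc uL => //; first exact: bb'.
  by rewrite -cE'.
have psiK : cancel psi phi.
  move=> v; rewrite /phi [RHS]cE' big_seq [RHS]big_seq; apply: eq_bigr => u uL.
  congr (_ *: _); apply: uniqc uL => //; first exact: bb.
  by rewrite -cE.
have deg (X Y : gradedModule K) (a : U -> X) (a' : U -> Y) cf d v : basis_family L a ->
    {in L, forall u, a u \in gpiece X (dg u)} ->
    {in L, forall u, a' u \in gpiece Y (dg u)} ->
    v = \sum_(u <- L) cf v u *: a u -> v \in gpiece X d ->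
    \sum_(u <- L) cf v u *: a' u \in gpiece Y d.
  move=> aa ad ad' vE; rewrite {1}vE => H; have c0 := basis_piece aa ad H.
  rewrite big_seq; elim/big_rec: _ => [|u y uL yd]; first exact: gpiece0.
  have [ud|ud] := eqVneq (dg u) d; last by rewrite c0 // scale0r add0r.
  by case: (gpiece_submod Y d) => _; apply => //; rewrite -ud ad'.
exists F; first by exists psi.
move=> d v; apply/idP/idP => [H|]; last exact: deg bb bd bd' (cE v).
by rewrite -(phiK v); apply: deg bb' bd' bd (cE' _) H.
Qed.

End GradedIso.

Section DirectSumBasis.
Variables (K : fieldType) (T : finType) (V : T -> gradedModule K).
Variables (U : T -> eqType) (L : forall t, seq (U t)) (b : forall t, U t -> V t).

Definition dsum_index : seq {t : T & U t} :=
  [seq Tagged U u | t <- enum T, u <- L t].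

Definition dsum_emb (p : {t : T & U t}) : gdsum V :=
  [ffun t => dfwith (fun t => 0 : V t) (b (tagged p)) t].

Lemma dsum_emb_piece p d :
  b (tagged p) \in gpiece (V (tag p)) d -> dsum_emb p \in gpiece (gdsum V) d.
Proof.
move=> bd; apply/dsum_pieceP=> t; rewrite ffunE.
by case: dfwithP => // j _; exact: gpiece0.
Qed.

Lemma dsum_basis : (forall t, basis_family (L t) (@b t)) ->
  basis_family dsum_index dsum_emb.
Proof.
move=> bb.
have sumE (c : {t : T & U t} -> K) t :
    (\sum_(p <- dsum_index) c p *: dsum_emb p : {dffun forall t, V t}) t =
    \sum_(u <- L t) c (Tagged U u) *: b u.
  rewrite dprod_sumE big_allpairs_dep /= (bigD1_seq t) ?mem_enum ?enum_uniq //=.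
  rewrite [X in _ + X]big1 ?addr0 => [|t' tt'].
    by apply: eq_bigr => u _; rewrite !ffunE dfwith_in.
  by apply: big1 => u _; rewrite !ffunE dfwith_out // scaler0.
split=> [v|c c0 p].
  have H t : exists c : U t -> K, (v : {dffun _}) t = \sum_(u <- L t) c u *: b u.
    by case: (bb t) => bsp _; exact: bsp.
  pose c (p : {t : T & U t}) := projT1 (cid (H (tag p))) (tagged p).
  exists c; apply/ffunP=> t; rewrite sumE /c /=; by case: (cid _).
case/allpairsPdep => t [u [_ uL ->]]; case: (bb t) => _ bind.
apply: (bind (fun u => c (Tagged U u))) => //.
by rewrite -sumE c0 ffunE.
Qed.

End DirectSumBasis.

(** * Bases of orbit harmonics quotients *)

Section Degree.
Variables (K : fieldType) (n : nat).
Implicit Types (f g h r : {mpoly K[n]}).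

Lemma pihomog_low d r : (msize r <= d)%N -> pihomog mdeg d r = 0.
Proof.
move=> rd; rewrite pihomogE big_seq_cond big1 // => m /andP[mr /eqP md].
by have := leq_trans (msize_mdeg_lt mr) rd; rewrite md ltnn.
Qed.

Lemma msize_homog d h : h \is d.-homog -> (msize h <= d.+1)%N.
Proof.
move=> /dhomogP hd; rewrite msizeE; apply/bigmax_leqP_seq => m mh _.
by rewrite ltnS hd.
Qed.

Lemma msizeD_bound d f g : (msize f <= d)%N -> (msize g <= d)%N -> (msize (f + g) <= d)%N.
Proof. by move=> fd gd; apply: leq_trans (msizeD_le _ _) _; rewrite geq_max fd. Qed.

Lemma msizeB_bound d f g : (msize f <= d)%N -> (msize g <= d)%N -> (msize (f - g) <= d)%N.
Proof.
move=> fd gd; apply: msizeD_bound => //; rewrite -scaleN1r.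
by apply: leq_trans gd; exact: msizeZ_le.
Qed.

Lemma homog_prod_card (T : finType) (S : {set T}) (F : T -> {mpoly K[n]}) :
  {in S, forall i, F i \is 1.-homog} -> \prod_(i in S) F i \is #|S|.-homog.
Proof.
move=> F1; rewrite -sum1_card.
elim/big_rec2: _ => [|i d f iS fd]; first exact: dhomog1.
by apply: dhomogM fd; exact: F1.
Qed.

Lemma pihomog_mul d e a f : a \is e.-homog -> (e <= d)%N ->
  pihomog mdeg d (a * f) = a * pihomog mdeg (d - e) f.
Proof.
move=> ae ed; rewrite {1}(pihomog_partitionE (leqnn (msize f))).
rewrite mulr_sumr raddf_sum /=.
have [lt|ge] := ltnP (d - e) (msize f); last first.
  rewrite (pihomog_low ge) mulr0 big1 // => k _.
  have kd : (e + k)%N != d.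
    apply: contraTneq ge => <-; rewrite addKn -ltnNge ltn_ord //.
  exact: (pihomog_ne0 kd (dhomogM ae (pihomogP _ _ _))).
rewrite (bigD1 (Ordinal lt)) //= [X in _ + X]big1 ?addr0 => [|k].
  by rewrite pihomog_dE // -{2}(subnKC ed); apply: dhomogM ae _; exact: pihomogP.
rewrite -val_eqE /= => kd.
have kd' : (e + k)%N != d.
  by apply: contra kd => /eqP <-; rewrite addKn.
exact: (pihomog_ne0 kd' (dhomogM ae (pihomogP _ _ _))).
Qed.

End Degree.

Section IdealGen.
Variables (K : fieldType) (A : comAlgType K).

Lemma ideal_gen_in (G : A -> Prop) g : G g -> g \in ideal_gen G.
Proof.
move=> Gg; apply/ideal_genP; exists [:: (1, g)]; last by rewrite big_seq1 mul1r.
by move=> p; rewrite inE => /eqP ->.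
Qed.

End IdealGen.

Section Orbit.
Variables (K : fieldType) (T : finType) (Z : seq {ffun T -> K}).
Implicit Types (f g h r : coordRing K T) (v w : {ffun T -> K}).

Lemma pevalD v f g : peval v (f + g) = peval v f + peval v g.
Proof. exact: mevalD. Qed.
Lemma pevalB v f g : peval v (f - g) = peval v f - peval v g.
Proof. exact: mevalB. Qed.
Lemma pevalM v f g : peval v (f * g) = peval v f * peval v g.
Proof. exact: mevalM. Qed.
Lemma pevalZ v c f : peval v (c *: f) = c * peval v f.
Proof. exact: mevalZ. Qed.
Lemma peval1 v : peval v 1 = 1.
Proof. exact: meval1. Qed.
Lemma peval0 v : peval v 0 = 0.
Proof. exact: meval0. Qed.
Lemma peval_var v t : peval v (cvar K t) = v t.
Proof. by rewrite /peval /cvar mevalXU enum_rankK. Qed.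
Lemma peval_sum v J (s : seq J) (P : pred J) (F : J -> coordRing K T) :
  peval v (\sum_(j <- s | P j) F j) = \sum_(j <- s | P j) peval v (F j).
Proof. exact: (big_morph (peval v) (pevalD v) (peval0 v)). Qed.
Lemma peval_prod v J (s : seq J) (P : pred J) (F : J -> coordRing K T) :
  peval v (\prod_(j <- s | P j) F j) = \prod_(j <- s | P j) peval v (F j).
Proof. exact: (big_morph (peval v) (pevalM v) (peval1 v)). Qed.

Lemma vanishingP f :
  reflect {in Z, forall v, peval v f = 0} (f \in vanishing_ideal Z).
Proof. by apply: (iffP allP) => H v /H /eqP. Qed.

Lemma vanishingD f g : f \in vanishing_ideal Z -> g \in vanishing_ideal Z ->
  f + g \in vanishing_ideal Z.
Proof.
by move=> /vanishingP If /vanishingP Ig; apply/vanishingP=> v vZ; rewrite pevalD If ?Ig ?addr0.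
Qed.

Lemma vanishingMl f g : g \in vanishing_ideal Z -> f * g \in vanishing_ideal Z.
Proof.
by move=> /vanishingP Ig; apply/vanishingP=> v vZ; rewrite pevalM Ig ?mulr0.
Qed.

(** A homogeneous [h] that is the top degree part of some vanishing polynomial; the
    case [h = 0] is included, which spares a nonvanishing hypothesis everywhere. *)
Lemma gr_ideal_top d h r : h \is d.-homog -> (msize r <= d)%N ->
  h + r \in vanishing_ideal Z -> h \in gr_ideal Z.
Proof.
move=> hd rd If; have hE : pihomog mdeg d (h + r) = h.
  by rewrite raddfD /= (pihomog_low rd) addr0 pihomog_dE.
have [->|h0] := eqVneq h 0; first exact: rpred0.
have sz : msize (h + r) = d.+1.
  apply/eqP; rewrite eqn_leq (msizeD_bound (msize_homog hd) (leqW rd)) /=.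
  by rewrite ltnNge; apply: contra h0 => /pihomog_low; rewrite hE => ->.
apply: ideal_gen_in; exists (h + r); split=> //; last by rewrite /top_form sz hE.
by apply: contraNneq h0 => E; rewrite -hE E raddf0.
Qed.

(** Conversely to [gr_ideal_top]: the degree [d] part of a combination of top forms
    is the top form of the corresponding combination of vanishing polynomials, or
    is cancelled to zero. *)
Lemma gr_ideal_lift d h : h \in gr_ideal Z ->
  exists2 r, (msize r <= d)%N & pihomog mdeg d h + r \in vanishing_ideal Z.
Proof.
case/ideal_genP=> s Gs ->; elim: s Gs => [|[a g] s IHs] Gs.
  exists 0; first by rewrite msize0.
  by rewrite big_nil raddf0 addr0; apply/vanishingP=> v _; rewrite peval0.
have [|r rd Ir] := IHs; first by move=> p ps; apply: Gs; rewrite inE ps orbT.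
have /= [f [f0 If gE]] := Gs (a, g) (mem_head _ _).
rewrite big_cons raddfD /=; set e := (msize f).-1.
have ge : g \is e.-homog by rewrite gE; exact: pihomogP.
have [ed|de] := leqP e d; last first.
  exists r => //; suff -> : pihomog mdeg d (a * g) = 0 by rewrite add0r.
  rewrite (pihomog_partitionE (leqnn (msize a))) mulr_suml raddf_sum big1 // => k _ /=.
  have kd : (k + e)%N != d by rewrite gtn_eqF // ltn_addl.
  exact: (pihomog_ne0 kd (dhomogM (pihomogP _ _ _) ge)).
rewrite mulrC (pihomog_mul _ ge ed) mulrC; set a' := pihomog _ _ _.
exists (a' * (f - g) + r).
  apply: msizeD_bound => //.
  have -> : f - g = \sum_(k < e) pihomog mdeg k f.
    rewrite gE {1}(pihomog_partitionE (leqnn (msize f))) /top_form.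
    have -> : msize f = e.+1 by rewrite prednK // lt0n msize_poly_eq0.
    by rewrite big_ord_recr /= addrK.
  rewrite mulr_sumr; apply: leq_trans (msize_sum _ _ _) _.
  apply/bigmax_leqP => k _.
  apply: leq_trans (msize_homog (dhomogM (pihomogP _ _ _) (pihomogP _ _ _))) _.
  by rewrite -{2}(subnK ed) ltn_add2l ltn_ord.
rewrite addrACA -mulrDr addrC subrKC; apply: vanishingD => //; exact: vanishingMl.
Qed.

Lemma separating_poly v (s : seq {ffun T -> K}) : v \notin s ->
  exists2 p, peval v p = 1 & {in s, forall w, peval w p = 0}.
Proof.
elim: s => [|w s IHs]; first by exists 1; rewrite ?peval1.
rewrite inE negb_or => /andP[vw /IHs[p pv ps]].
have [t vwt] : exists t, v t != w t.
  by apply/existsP; rewrite -negb_forall; apply: contra vw => /forallP E;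
     apply/eqP/ffunP => t; apply/eqP.
exists ((v t - w t)^-1 *: (cvar K t - w t *: 1) * p).
  rewrite pevalM pevalZ pevalB pevalZ peval_var peval1 pv !mulr1 mulVf //.
  by rewrite subr_eq0.
move=> x; rewrite inE => /predU1P[->|xs]; last by rewrite pevalM ps ?mulr0.
by rewrite pevalM pevalZ pevalB pevalZ peval_var peval1 mulr1 subrr mulr0 mul0r.
Qed.

Variables (U : eqType) (L : seq U) (m : U -> coordRing K T) (dg : U -> nat).
Hypothesis uniqZ : uniq Z.
Hypothesis le_size : (size L <= size Z)%N.
Hypothesis m_homog : forall u, m u \is (dg u).-homog.
Hypothesis m_span : forall f, exists c : U -> K,
  f - \sum_(u <- L) c u *: m u \in gr_ideal Z.

(** Spanning modulo the homogeneous ideal lifts to spanning of functions on [Z], with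
    control on degrees: the leading part of [f] is written in the spanning family up
    to an element of the ideal, which [gr_ideal_lift] trades for a polynomial of
    smaller degree. *)
Lemma vanishing_approx n f : (msize f <= n)%N -> exists2 c : U -> K,
  forall u, (n <= dg u)%N -> c u = 0 &
  f - \sum_(u <- L) c u *: m u \in vanishing_ideal Z.
Proof.
elim: n f => [|n IHn] f fn.
  exists (fun=> 0) => //; rewrite big1 => [|u _]; last by rewrite scale0r.
  have -> : f = 0 by apply/eqP; rewrite -msize_poly_eq0 -leqn0.
  by rewrite subr0; apply/vanishingP=> v _; rewrite peval0.
pose h := pihomog mdeg n f; have [c cE] := m_span h.
have [r rn Ir] := gr_ideal_lift n cE.
have fh : (msize (f - h) <= n)%N.
  rewrite {1}(pihomog_partitionE fn) big_ord_recr /= addrK.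
  apply: leq_trans (msize_sum _ _ _) _; apply/bigmax_leqP => k _.
  exact: leq_trans (msize_homog (pihomogP _ _ _)) (ltn_ord k).
have [c' c'0 Ic'] := IHn _ (msizeB_bound fh rn).
exists (fun u => (if dg u == n then c u else 0) + c' u).
  move=> u nu; rewrite gtn_eqF // add0r; apply: c'0; exact: ltnW.
set S' := \sum_(u <- L) c' u *: m u in Ic'.
pose S := pihomog mdeg n (\sum_(u <- L) c u *: m u).
have -> : \sum_(u <- L) ((if dg u == n then c u else 0) + c' u) *: m u = S + S'.
  rewrite /S raddf_sum -big_split /=; apply: eq_bigr => u _; rewrite scalerDl; congr (_ + _).
  rewrite linearZ /=; have [<-|un] := eqVneq (dg u) n; first by rewrite pihomog_dE.
  by rewrite (pihomog_ne0 un) // scale0r scaler0.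
have -> : f - (S + S') = (pihomog mdeg n (h - \sum_(u <- L) c u *: m u) + r) + (f - h - r - S').
  rewrite raddfB /= (pihomog_dE (pihomogP mdeg n f)) -/h -/S; ring.
exact: vanishingD.
Qed.

(** The functions on [Z] form a space of dimension [size Z], and by
    [vanishing_approx] it is spanned by at most [size Z] elements; so the evaluation
    matrix is square and invertible. *)
Lemma vanishing_indep c : \sum_(u <- L) c u *: m u \in vanishing_ideal Z ->
  {in L, forall u, c u = 0}.
Proof.
move=> /vanishingP c0.
pose z (j : 'I_(size Z)) := tnth (in_tuple Z) j.
pose l (i : 'I_(size L)) := tnth (in_tuple L) i.
have sumL (F : U -> coordRing K T) : \sum_(u <- L) F u = \sum_(i < size L) F (l i).
  by rewrite big_tnth.
pose E : 'M[K]_(size L, size Z) := \matrix_(i, j) peval (z j) (m (l i)).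
have z_inj : injective z by apply/tuple_uniqP; exact: uniqZ.
have zZ j : z j \in Z by exact: mem_tnth.
(* Row [k] of a left inverse of the evaluation matrix expresses the indicator
     function of the [k]-th point. *)
have /fin_all_exists[a aE] (k : 'I_(size Z)) : exists a : U -> K,
    forall j, \sum_(i < size L) a (l i) * E i j = (k == j)%:R.
  have [|p pk p0] := @separating_poly (z k) (rem (z k) Z).
    by rewrite mem_rem_uniqF.
  have [a _ /vanishingP aI] := vanishing_approx (leqnn (msize p)).
  exists a => j; transitivity (peval (z j) p).
    have := aI _ (zZ j); rewrite pevalB => /eqP; rewrite subr_eq0 => /eqP ->.
    by rewrite sumL peval_sum; apply: eq_bigr => i _; rewrite pevalZ mxE.
  case: eqP => [<-//|kj]; rewrite p0 //.
  by rewrite mem_rem_uniq // inE zZ andbT; apply/eqP=> /z_inj/esym.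
have full : row_full E.
  apply/row_fullP; exists (\matrix_(k, i) a k (l i)); apply/matrixP=> k j.
  by rewrite !mxE -aE; apply: eq_bigr => i _; rewrite mxE.
have free : row_free E.
  rewrite /row_free eqn_leq rank_leq_row /=; move: full; rewrite /row_full => /eqP ->.
  exact: le_size.
pose C : 'rV[K]_(size L) := \row_i c (l i).
have /eqP : C *m E = 0.
  apply/matrixP=> i j; rewrite !mxE; have := c0 _ (zZ j).
  rewrite sumL peval_sum => E0; rewrite -[RHS]E0; apply: eq_bigr => k _.
  by rewrite !mxE pevalZ.
rewrite mulmx_free_eq0 // => /eqP C0 u uL.
have iL : (index u L < size L)%N by rewrite index_mem.
have := congr1 (fun C : 'rV_(size L) => C 0 (Ordinal iL)) C0.
by rewrite !mxE /l (tnth_nth u) /= nth_index.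
Qed.

(** The part of degree [d] of a relation modulo the homogeneous ideal is completed by
    lower terms to a vanishing polynomial. These lower terms are combinations of
    family members of degree less than [d], so [vanishing_indep] applies. *)
Lemma gr_ideal_indep c : \sum_(u <- L) c u *: m u \in gr_ideal Z ->
  {in L, forall u, c u = 0}.
Proof.
move=> c0 u uL; set d := dg u.
have [r rd] := gr_ideal_lift d c0.
have -> : pihomog mdeg d (\sum_(u <- L) c u *: m u) =
    \sum_(u <- L) (if dg u == d then c u else 0) *: m u.
  rewrite raddf_sum; apply: eq_bigr => w _ /=; rewrite linearZ /=.
  have [<-|wd] := eqVneq (dg w) d; first by rewrite pihomog_dE.
  by rewrite (pihomog_ne0 wd) // scale0r scaler0.
have [c' c'0 /vanishingP Ic'] := vanishing_approx rd => /vanishingP Ic.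
have /vanishing_indep/(_ u uL) :
    \sum_(u <- L) ((if dg u == d then c u else 0) + c' u) *: m u \in vanishing_ideal Z.
  apply/vanishingP => v vZ; have := Ic v vZ; have := Ic' v vZ.
  rewrite pevalB => /eqP; rewrite subr_eq0 pevalD => /eqP ->.
  rewrite -pevalD -big_split /= => H; rewrite -[RHS]H; congr (peval v _).
  by apply: eq_bigr => w _; rewrite scalerDl.
by rewrite eqxx c'0 // addr0.
Qed.

Lemma orbit_basis : basis_family L (fun u => orbit_pi Z (m u)).
Proof.
have piE c : \sum_(u <- L) c u *: orbit_pi Z (m u) = orbit_pi Z (\sum_(u <- L) c u *: m u).
  rewrite /orbit_pi (raddf_sum (quot_pi (top_forms Z))).
  by apply: eq_bigr => u _; exact: quot_scaleE.
split=> [v|c].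
  have [f ->] := quot_pi_surj v; have [c cE] := m_span f; exists c.
  by rewrite piE; apply/quot_piP.
rewrite piE => H; apply: gr_ideal_indep.
have /quot_piP : quot_pi (top_forms Z) (\sum_(u <- L) c u *: m u) = quot_pi _ 0.
  by rewrite raddf0.
by rewrite subr0.
Qed.

End Orbit.

(** * Spanning by NBC monomials *)

Lemma big_disjointU (R : Type) (idx : R) (op : Monoid.com_law idx) (J : finType)
    (C D : {set J}) (F : J -> R) : [disjoint C & D] ->
  \big[op/idx]_(i in C :|: D) F i =
    op (\big[op/idx]_(i in C) F i) (\big[op/idx]_(i in D) F i).
Proof.
by move=> CD; rewrite -bigU //; apply: eq_bigl => i; rewrite !inE.
Qed.

Section Congruence.
Variables (K : fieldType) (A : comAlgType K) (Q : A -> Prop).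

(** A predicate version of ideals that does not exclude the unit ideal. *)
Definition is_ideal := [/\ Q 0, forall f g, Q f -> Q g -> Q (f + g)
  & forall a f, Q f -> Q (a * f)].

Hypothesis Qideal : is_ideal.

Lemma ideal0 : Q 0. Proof. by case: Qideal. Qed.
Lemma idealD f g : Q f -> Q g -> Q (f + g). Proof. by case: Qideal => _ H _; exact: H. Qed.
Lemma idealMl a f : Q f -> Q (a * f). Proof. by case: Qideal => _ _; exact. Qed.
Lemma idealMr a f : Q f -> Q (f * a). Proof. by rewrite mulrC; exact: idealMl. Qed.
Lemma idealZ c f : Q f -> Q (c *: f).
Proof. by rewrite -mulr_algl; exact: idealMl. Qed.
Lemma idealN f : Q f -> Q (- f).
Proof. by rewrite -scaleN1r; exact: idealZ. Qed.
Lemma idealB f g : Q f -> Q g -> Q (f - g).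
Proof. by move=> Qf /idealN; exact: idealD. Qed.
Lemma ideal_congr f g : Q (f - g) -> Q g -> Q f.
Proof. by move=> Qfg Qg; rewrite -(subrK g f); exact: idealD. Qed.
Lemma ideal_sym f g : Q (f - g) -> Q (g - f).
Proof. by rewrite -(opprB g f) => /idealN; rewrite opprK. Qed.

Lemma ideal_sum J (r : seq J) (P : pred J) (F : J -> A) :
  (forall j, P j -> Q (F j)) -> Q (\sum_(j <- r | P j) F j).
Proof. by move=> QF; apply: (big_ind Q) => //; [exact: ideal0|exact: idealD]. Qed.

Lemma prod_congr J (r : seq J) (P : pred J) (F G : J -> A) :
  (forall j, P j -> Q (F j - G j)) ->
  Q (\prod_(j <- r | P j) F j - \prod_(j <- r | P j) G j).
Proof.
move=> QF; elim/big_rec2: _ => [|j f g Pj fg]; first by rewrite subrr; exact: ideal0.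
have -> : F j * g - G j * f = F j * (g - f) + f * (F j - G j) by ring.
by apply: idealD; apply: idealMl => //; exact: QF.
Qed.

Lemma elem_sym_congr (T : finType) k (S : {set T}) (F G : T -> A) :
  {in S, forall i, Q (F i - G i)} -> Q (elem_sym k S F - elem_sym k S G).
Proof.
move=> QF; rewrite /elem_sym -sumrB; apply: ideal_sum => C /andP[/subsetP CS _].
by apply: prod_congr => i /CS; exact: QF.
Qed.

Section Spanned.
Variables (U : eqType) (L : seq U) (m : U -> A).

Definition spanned f := exists c : U -> K, Q (f - \sum_(u <- L) c u *: m u).

Lemma ideal_spanned f : Q f -> spanned f.
Proof.
by move=> Qf; exists (fun=> 0); rewrite big1 ?subr0 // => u _; rewrite scale0r.
Qed.

Lemma spanned0 : spanned 0.
Proof. exact: ideal_spanned ideal0. Qed.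

Lemma spannedD f g : spanned f -> spanned g -> spanned (f + g).
Proof.
move=> [c cE] [d dE]; exists (fun u => c u + d u).
have -> : \sum_(u <- L) (c u + d u) *: m u =
   \sum_(u <- L) c u *: m u + \sum_(u <- L) d u *: m u.
  by rewrite -big_split; apply: eq_bigr => u _; rewrite scalerDl.
by rewrite opprD addrACA; apply: idealD.
Qed.

Lemma spannedZ a f : spanned f -> spanned (a *: f).
Proof.
move=> [c cE]; exists (fun u => a * c u).
have -> : \sum_(u <- L) (a * c u) *: m u = a *: \sum_(u <- L) c u *: m u.
  by rewrite scaler_sumr; apply: eq_bigr => u _; rewrite scalerA.
by rewrite -scalerBr; apply: idealZ.
Qed.

Lemma spanned_congr f g : Q (f - g) -> spanned g -> spanned f.
Proof.
move=> Qfg Pg; rewrite -(subrK g f); apply: spannedD => //; exact: ideal_spanned.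
Qed.

Lemma spanned_in u : uniq L -> u \in L -> spanned (m u).
Proof.
move=> uniq_index uL; exists (fun w => (w == u)%:R).
suff -> : \sum_(w <- L) (w == u)%:R *: m w = m u by rewrite subrr; exact: ideal0.
rewrite (bigD1_seq u) //= eqxx scale1r -[RHS]addr0; congr (_ + _).
by apply: big1 => w /negPf->; rewrite scale0r.
Qed.

Lemma spanned_sum J (r : seq J) (F : J -> A) :
  (forall j, spanned (F j)) -> spanned (\sum_(j <- r) F j).
Proof.
by move=> PF; apply: (big_ind spanned) => //; [exact: spanned0|exact: spannedD].
Qed.

End Spanned.
End Congruence.

(** The sign for which [y_i^s] is congruent to [sign_coef s *: y_i^+] in the
    quotients below. *)
Definition sign_coef (K : fieldType) (s : option bool) : K :=
  if s == Some true then 1 else -1.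

Lemma sign_coefK (K : fieldType) s : sign_coef K s * sign_coef K s = 1.
Proof. by rewrite /sign_coef; case: ifP => _; rewrite ?mulr1 // mulrNN mulr1. Qed.

Lemma prod_sign_coefK (K : fieldType) J (r : seq J) (P : pred J) (s : J -> option bool) :
  (\prod_(j <- r | P j) sign_coef K (s j)) * (\prod_(j <- r | P j) sign_coef K (s j)) = 1.
Proof. by rewrite -big_split big1 // => j _; rewrite /= sign_coefK. Qed.

Section NBCSpan.
Variables (K : fieldType) (T I : finType) (M : {set signed I}) (le : rel I).
Hypothesis le_order : total_order le.
Local Notation A := (coordRing K T).
Variables (Q V : A -> Prop) (p : A) (u : I -> A).
Implicit Types (N C D S : {set I}).
Hypothesis Qideal : is_ideal Q.
Hypothesis V0 : V 0.
Hypothesis VD : forall f g, V f -> V g -> V (f + g).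
Hypothesis VZ : forall c f, V f -> V (c *: f).
Hypothesis pQ : forall f, Q f -> V (p * f).

Local Notation mono N := (\prod_(i in N) u i).

Hypothesis u_sq : forall i, Q (u i * u i).
Hypothesis u_circuit : forall X, circuit M X ->
  Q (\prod_(i in supp X) (sign_coef K (X i) *: u i)).
Hypothesis u_symmetric : forall X, symmetric_circuit M X -> supp X != set0 ->
  Q (elem_sym #|supp X|.-1 (supp X) (fun i => sign_coef K (X i) *: u i)).
Hypothesis u_NBC : forall N, N \in NBC M le -> V (p * mono N).

Lemma exists_min S : S != set0 -> exists2 m, m \in S & {in S, forall i, le m i}.
Proof.
case: le_order => tot tr anti; apply: (@exists_max I (fun i j => le j i)).
split=> [i j|j i k ij jk|i j ij]; [exact: tot|exact: tr jk ij|exact/esym/anti].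
Qed.

Lemma drop_smallestE S m : m \in S -> {in S, forall i, le m i} ->
  drop_smallest le S = S :\ m.
Proof.
case: le_order => tot tr anti mS mmin; apply/setP=> i; rewrite !inE andbC.
case iS : (i \in S); rewrite ?andbF ?andbT //; congr (~~ _).
apply/forall_inP/eqP => [H|-> //]; apply: anti; by rewrite H // mmin.
Qed.

(** The sum of the ranks of the elements of [N] is the measure that decreases when a
    broken circuit is replaced. *)
Definition rank_of i := #|[set j | le j i]|.

Lemma rank_lt i j : le i j -> i != j -> (rank_of i < rank_of j)%N.
Proof.
case: le_order => tot tr anti ij nij; apply: proper_card; apply/properP; split.
  by apply/subsetP=> k; rewrite !inE => ki; apply: tr ki ij.
exists j; rewrite !inE; first by have := tot j j; rewrite orbb.
by apply: contra nij => ji; apply/eqP/anti; rewrite ij.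
Qed.

Lemma monomial_disjoint C D : [disjoint C & D] -> mono C * mono D = mono (C :|: D).
Proof. by move=> CD; rewrite big_disjointU. Qed.

Lemma monomial_circuit N X : circuit M X -> supp X \subset N -> V (p * mono N).
Proof.
move=> cX XN; apply: pQ.
have <- : mono (supp X) * mono (N :\: supp X) = mono N.
  by rewrite [RHS](big_setID (supp X)) /= (setIidPr XN).
apply: (idealMr Qideal); have := u_circuit cX.
rewrite scaler_prod => /(idealZ Qideal (\prod_(i in supp X) sign_coef K (X i))).
by rewrite scalerA prod_sign_coefK scale1r.
Qed.

(** Induction on the sum of ranks. If [N] is not an NBC set, either it contains the
    support of a circuit and its monomial is in [Q], or it contains [D], the support
    of a symmetric circuit without its least element [m]. In the relation given by
    the elementary symmetric polynomial of degree one less than the support, [D]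
    indexes the monomial to be rewritten and every other term contains [m] in place
    of a larger element. *)
Lemma monomial_span N : V (p * mono N).
Proof.
have [k] := ubnP (\sum_(i in N) rank_of i)%N; elim: k => // k IHk in N *.
rewrite ltnS => Nk; have [/u_NBC//|] := boolP (N \in NBC M le).
rewrite inE negb_and !negb_forall => /orP[] /existsP[X].
  by rewrite negb_imply negbK => /andP[cX XN]; exact: monomial_circuit XN.
rewrite negb_imply negbK => /andP[sX]; have [cX _] := andP sX.
have [S0|S0] := eqVneq (supp X) set0.
  by move=> _; apply: (monomial_circuit cX); rewrite S0 sub0set.
have [m mS mmin] := exists_min S0; rewrite (drop_smallestE mS mmin).
set S := supp X in mS mmin *; set D := S :\ m => DN.
have SE : S = m |: D by rewrite setD1K.
have [mN|mN] := boolP (m \in N).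
  by apply: (monomial_circuit cX); rewrite -/S SE subUset sub1set mN.
have mD : m \notin D by rewrite !inE eqxx.
have DND : [disjoint D & N :\: D].
  by rewrite -setI_eq0 setIDA setIC -setIDA setDv setI0.
have NE : N = D :|: (N :\: D).
  by rewrite -[LHS](setID N D) (setIidPr DN).
have cardD : #|D| = #|S|.-1 by rewrite (cardsD1 m S) mS.
have := u_symmetric sX S0; rewrite -/S => /(idealMr Qideal (mono (N :\: D))) /pQ.
rewrite /elem_sym (bigD1 D) /=; last by rewrite subD1set cardD eqxx.
rewrite mulrDl mulrDr scaler_prod -scalerAl monomial_disjoint // -NE -scalerAr.
set a := \prod_(i in D) _; set x := _ *: (p * mono N); set y := p * (_ * _) => Vxy.
have Vy : V y.
  rewrite /y mulr_suml mulr_sumr; apply: (big_ind V) => // C /andP[/andP[CS Cc] CD].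
  (* A set of the size of [D] in [m |: D] other than [D] contains [m]. *)
  have mC : m \in C.
    apply: contraR CD => mC; rewrite eqEcard cardD (eqP Cc) leqnn andbT.
    by apply/subsetD1P.
  have CND : [disjoint C & N :\: D].
    rewrite disjoint_subset; apply/subsetP=> i /(subsetP CS); rewrite !inE.
    by have [->|] := eqVneq i m; rewrite ?(negPf mN) ?andbF //= => _ ->.
  rewrite scaler_prod -scalerAl monomial_disjoint // -scalerAr; apply: VZ; apply: IHk.
  apply: leq_trans Nk; rewrite [in X in (_ < X)%N]NE !big_disjointU //=.
  rewrite ltn_add2r (big_setD1 m mC) /=.
  have CD' : C :\ m \subset D by apply: setSD.
  have /set0Pn[j /setDP[jD jC]] : D :\: (C :\ m) != set0.
    rewrite setD_eq0; apply: contra CD => DC; rewrite eq_sym eqEcard cardD (eqP Cc) leqnn.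
    by rewrite (subset_trans DC) // subD1set.
  have mj : m != j by case/setD1P: jD; rewrite eq_sym.
  rewrite [X in (_ < X)%N](big_setD1 j jD) /= -addSn; apply: leq_add.
    by apply: rank_lt => //; apply: mmin; case/setD1P: jD.
  have CDj : C :\ m \subset D :\ j by rewrite subsetD1 CD'.
  by rewrite [X in (_ <= X)%N](big_setID (C :\ m)) /= (setIidPr CDj) leq_addr.
have : V x by rewrite -(addrK y x) -scaleN1r; apply: VD => //; exact: VZ.
by rewrite /x => /(VZ a); rewrite scalerA prod_sign_coefK scale1r.
Qed.

(** The hypothesis says that modulo [Q] every variable is zero or a scalar multiple
    of some [u i]; together with [u_sq] this makes products of variables reduce to
    squarefree monomials. *)
Lemma monomials_generate : (forall t, Q (cvar K t) \/ exists i c, Q (cvar K t - c *: u i)) ->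
  forall f, spanned Q (index_enum {set I}) (fun N => mono N) f.
Proof.
move=> Hvar; set P := spanned _ _ _.
have Pmono N : P (mono N).
  by apply: (@spanned_in _ _ _ Qideal _ _ (fun N => mono N) N);
     rewrite ?index_enum_uniq ?mem_index_enum.
have Pu i N : P (u i * mono N).
  have [iN|iN] := boolP (i \in N).
    by apply: ideal_spanned; rewrite (big_setD1 i iN) /= mulrA; exact: idealMr.
  by have := Pmono (i |: N); rewrite big_setU1.
have Pvar t f : P f -> P (cvar K t * f).
  move=> [c cE]; have [Qt|[i [a Qi]]] := Hvar t.
    by apply: ideal_spanned; exact: idealMr.
  apply: (@spanned_congr _ _ _ Qideal _ _ _ _ ((a *: u i) * f)).
    by rewrite -mulrBl; exact: idealMr.
  apply: (@spanned_congr _ _ _ Qideal _ _ _ _ ((a *: u i) * \sum_N c N *: mono N)).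
    by rewrite -mulrBr; exact: idealMl.
  rewrite mulr_sumr; apply: spanned_sum => // N; rewrite -scalerAl -scalerAr.
  by apply: spannedZ => //; exact: (spannedZ Qideal _ (Pu _ _)).
have P1 : P 1 by have := Pmono set0; rewrite big_set0.
elim/mpolyind => [|c m f _ _ Pf]; first exact: spanned0.
apply: spannedD => //; apply: spannedZ => //; rewrite mpolyXE_id.
elim/big_rec: _ => [//|k g _ Pg]; elim: (m k) => [|e IHe]; first by rewrite mul1r.
rewrite exprS -mulrA; have := Pvar (enum_val k) _ IHe.
by rewrite /cvar enum_valK.
Qed.

(** The common spanning argument for both loci: [V] is the set of elements already
    known to be spanned and [p] is [1] for the small locus and the monomial of a
    basic set for the big one. *)
Lemma span_all : (forall t, Q (cvar K t) \/ exists i c, Q (cvar K t - c *: u i)) ->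
  forall f, V (p * f).
Proof.
move=> /monomials_generate span f; have [c cE] := span f.
rewrite -(subrK (\sum_N c N *: mono N) f) mulrDr; apply: VD; first exact: pQ.
rewrite mulr_sumr; apply: (big_ind V) => // N _.
by rewrite -scalerAr; apply: VZ; exact: monomial_span.
Qed.

End NBCSpan.

(** * Top degree forms of vanishing polynomials *)

Lemma prod_sub1_expand (R : comNzRingType) (J : finType) (S : {set J}) (t : J -> R) :
  \prod_(i in S) (1 - t i) =
  \sum_(C : {set J} | C \subset S) (-1) ^+ #|C| * \prod_(i in C) t i.
Proof.
pose a i := if i \in S then - t i else 0.
transitivity (\prod_i (a i + 1)).
  rewrite big_mkcond; apply: eq_bigr => i _; rewrite /a; case: ifP => _; last by rewrite add0r.
  by rewrite addrC.
rewrite bigA_distr (bigID (fun C : {set J} => C \subset S)) /= [X in _ + X]big1 ?addr0 => [|C].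
  apply: eq_bigr => C CS; rewrite -prodrN [RHS]big_mkcond.
  by apply: eq_bigr => i _; case: ifP => // /(subsetP CS); rewrite /a => ->.
by case/subsetPn => i iC iS; rewrite (bigD1 i) //= iC /a (negPf iS) mul0r.
Qed.

Section TopForms.
Variables (K : fieldType) (T : finType) (Z : seq {ffun T -> K}).
Local Notation A := (coordRing K T).

Lemma is_ideal_gr : is_ideal (fun f => f \in gr_ideal Z).
Proof.
split=> [|f g|a f]; [exact: rpred0|exact: rpredD|exact: ideal_gen_mull].
Qed.

Lemma cvar_homog (t : T) : cvar K t \is 1.-homog.
Proof. by rewrite /cvar dhomogX; apply/eqP; exact: mdeg1. Qed.

Lemma homog_vanishing d (f : A) : f \is d.-homog -> f \in vanishing_ideal Z -> f \in gr_ideal Z.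
Proof. by move=> fd If; apply: (@gr_ideal_top _ _ _ d f 0); rewrite ?msize0 ?addr0. Qed.

(** If [p] times the product of the [t i] and [p] times the product of the [1 - t i]
    both vanish on [Z], combine them so that the terms of top degree cancel: the
    remaining leading form is [p] times the elementary symmetric polynomial of
    degree one less. *)
Lemma gr_ideal_elem_sym (J : finType) (S : {set J}) (t : J -> A) d (p : A) :
  p \is d.-homog -> {in S, forall i, t i \is 1.-homog} -> S != set0 ->
  p * \prod_(i in S) t i \in vanishing_ideal Z ->
  p * \prod_(i in S) (1 - t i) \in vanishing_ideal Z ->
  p * elem_sym #|S|.-1 S t \in gr_ideal Z.
Proof.
move=> pd t1 S0 I1 I2; set e := #|S|.-1.
have Se : #|S| = e.+1 by rewrite prednK // card_gt0.
have tC (C : {set J}) : C \subset S -> \prod_(i in C) t i \is #|C|.-homog.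
  by move=> CS; apply: homog_prod_card => i /(subsetP CS); exact: t1.
pose low := \sum_(C : {set J} | (C \subset S) && (#|C| < e)%N) (-1) ^+ #|C| * \prod_(i in C) t i.
have E : \prod_(i in S) (1 - t i) =
    (-1) ^+ e.+1 * \prod_(i in S) t i + ((-1) ^+ e * elem_sym e S t + low).
  rewrite prod_sub1_expand (bigD1 S) //= -Se; congr (_ + _).
  rewrite (bigID (fun C : {set J} => #|C| == e)) /=; congr (_ + _).
    rewrite /elem_sym mulr_sumr; apply: eq_big => [C|C /andP[_ /eqP->] //].
    case: (#|C| =P e) => [Ce|]; rewrite ?andbF ?andbT //.
    by case: (C =P S) => [CS|]; rewrite ?andbT //; move: Se; rewrite -CS Ce => E; case: (n_Sn _ E).
  apply: eq_bigl => C; case CS : (C \subset S) => //=.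
  have := subset_leq_card CS; rewrite Se leq_eqVlt => /orP[/eqP Ce|Ce].
    have -> : C = S by apply/eqP; rewrite eqEcard CS Se Ce leqnn.
    by rewrite eqxx Se ltnNge leqnSn.
  have -> /= : C != S by apply: contraTneq Ce => ->; rewrite Se ltnn.
  by rewrite [in RHS]ltn_neqAle -ltnS Ce andbT.
apply: (@gr_ideal_top _ _ _ (d + e) _ ((-1) ^+ e * (p * low))).
- apply: dhomogM => //; rewrite /elem_sym; apply: rpred_sum => C /andP[CS /eqP <-].
  exact: tC.
- rewrite /low 2!mulr_sumr; apply: leq_trans (msize_sum _ _ _) _.
  apply/bigmax_leqP => C /andP[CS Ce].
  have sgnh k : ((-1) ^+ k : A) \is 0.-homog.
    have h1 : (-1 : A) \is 0.-homog by rewrite dhomogN dhomog1.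
    exact: (dhomogMn k h1).
  apply: leq_trans (msize_homog (_ : _ \is (d + #|C|).-homog)) _.
    exact: (dhomogM (sgnh e) (dhomogM pd (dhomogM (sgnh #|C|) (tC C CS)))).
  by rewrite -addnS leq_add2l.
have -> : p * elem_sym e S t + (-1) ^+ e * (p * low) =
    (-1) ^+ e * (p * \prod_(i in S) (1 - t i)) + p * \prod_(i in S) t i.
  have ee : (-1) ^+ e * (-1) ^+ e = 1 :> A by rewrite -exprD addnn -mul2n exprM sqrrN !expr1n.
  rewrite E exprS; move: ee; move: ((-1) ^+ e : A) => x ee.
  transitivity (p * (x * x) * elem_sym e S t + x * (p * low)).
    by rewrite ee mulr1.
  transitivity (x * (p * (-1 * x * \prod_(i in S) t i + (x * elem_sym e S t + low))) +
                p * (x * x) * \prod_(i in S) t i).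
    ring.
  by rewrite ee mulr1.
apply: vanishingD => //; exact: vanishingMl.
Qed.

End TopForms.

(** * The small locus *)

Section SmallLocus.
Variables (K : fieldType) (I : finType) (M : {set signed I}) (le : rel I).
Hypothesis M_COM : is_COM M.
Hypothesis le_order : total_order le.
Local Notation Z := (small_locus K M).
Local Notation A := (coordRing K (I * bool)%type).
Local Notation y i s := (cvar K (i, s)).
Local Notation Q := (fun f : A => f \in gr_ideal Z).

Definition small_mono (N : {set I}) : A := \prod_(i in N) y i true.

Lemma small_locusP v : reflect (exists2 X, X \in topes M & v = ypoint K X) (v \in Z).
Proof. exact: imageP. Qed.

Lemma topesP X : reflect (X \in M /\ forall i, X i != None) (X \in topes M).
Proof. by rewrite inE; apply: (iffP andP) => -[XM] => [/forallP|H]; split=> //; apply/forallP. Qed.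

Lemma small_linear i : y i true + y i false \in gr_ideal Z.
Proof.
apply: (@gr_ideal_top _ _ _ 1 _ (-1)).
- by rewrite rpredD ?cvar_homog.
- by rewrite -scaleN1r; apply: leq_trans (msizeZ_le _ _) _; rewrite msize1.
apply/vanishingP => v /small_locusP[X /topesP[_ X0] ->].
rewrite pevalB pevalD peval1 !peval_var !ffunE /=.
by case: (X i) (X0 i) => [[]|] // _; rewrite /= ?addr0 ?add0r subrr.
Qed.

Lemma small_quad i s : y i s * y i s \in gr_ideal Z.
Proof.
apply: (@gr_ideal_top _ _ _ 2 _ (- y i s)).
- exact: (dhomogM (cvar_homog _ _) (cvar_homog _ _)).
- rewrite -scaleN1r; apply: leq_trans (msizeZ_le _ _) _.
  exact: msize_homog (cvar_homog _ _).
apply/vanishingP => v /small_locusP[X _ ->].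
rewrite pevalB pevalM !peval_var !ffunE /=; case: eqP => _; by rewrite ?mulr1 ?mulr0 subrr.
Qed.

Lemma small_sign i (s : option bool) : s != None ->
  Q (sign_coef K s *: y i true - y i (s == Some true)).
Proof.
case: s => [[]|] // _ /=; rewrite /sign_coef /= ?scale1r ?subrr ?rpred0 //.
by rewrite scaleN1r -opprD rpredN small_linear.
Qed.

Lemma prod_small_ne0 (X Y : signed I) (S : {set I}) :
  \prod_(i in S) peval (ypoint K Y) (y i (X i == Some true)) != 0 ->
  {in S, forall i, Y i = Some (X i == Some true)}.
Proof.
move=> /prodf_neq0 H i iS; have := H i iS; rewrite peval_var ffunE /=.
by case: (Y i =P _) => // _; rewrite eqxx.
Qed.

Lemma no_covector_above X : circuit M X -> forall Y, Y \in M ->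
  ~ (forall i, X i != None -> Y i = X i).
Proof. by case/andP=> /forall_inP H _ Y YM /scomp_fixP YX; have := H Y YM; rewrite YX. Qed.

Lemma small_circuit_vanish X : circuit M X ->
  \prod_(i in supp X) y i (X i == Some true) \in vanishing_ideal Z.
Proof.
move=> cX; apply/vanishingP => v /small_locusP[Y /topesP[YM _] ->].
rewrite peval_prod; apply/eqP; apply/negPn/negP => /prod_small_ne0 H.
apply: (no_covector_above cX YM) => i Xi; rewrite H ?inE //.
by case: (X i) Xi => [[]|].
Qed.

Lemma small_circuit X : circuit M X ->
  Q (\prod_(i in supp X) (sign_coef K (X i) *: y i true)).
Proof.
move=> cX; apply: (ideal_congr (is_ideal_gr Z) (g := \prod_(i in supp X) y i (X i == Some true))).
  apply: (prod_congr (is_ideal_gr Z)) => i; rewrite inE; exact: small_sign.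
apply: (homog_vanishing (d := #|supp X|)); last exact: small_circuit_vanish.
by apply: homog_prod_card => i _; exact: cvar_homog.
Qed.

(** A symmetric circuit excludes both sign patterns [X] and [-X] on its support; at a
    tope, [1 - y_i^s] is [y_i^{-s}]. *)
Lemma small_symmetric X : symmetric_circuit M X -> supp X != set0 ->
  Q (elem_sym #|supp X|.-1 (supp X) (fun i => sign_coef K (X i) *: y i true)).
Proof.
move=> /andP[cX cNX] S0.
apply: (ideal_congr (is_ideal_gr Z)
  (g := elem_sym #|supp X|.-1 (supp X) (fun i => y i (X i == Some true)))).
  apply: (elem_sym_congr (is_ideal_gr Z)) => i; rewrite inE; exact: small_sign.
rewrite -[X in X \in _]mul1r; apply: (gr_ideal_elem_sym (d := 0)) => //.
- exact: dhomog1.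
- by move=> i _; exact: cvar_homog.
- by rewrite mul1r; exact: small_circuit_vanish.
rewrite mul1r; apply/vanishingP => v /small_locusP[Y /topesP[YM Y0] ->].
rewrite peval_prod; apply/eqP; apply/negPn/negP => /prodf_neq0 H.
apply: (no_covector_above cNX YM) => i; rewrite ffunE => Xi.
have Xi' : X i != None by case: (X i) Xi.
have := H i; rewrite inE => /(_ Xi'); rewrite pevalB peval1 peval_var ffunE /=.
by case: (X i) Xi' => [[]|] // _; case: (Y i) (Y0 i) => [[]|] //= _; rewrite subrr eqxx.
Qed.

Lemma small_span f : spanned Q (enum (NBC M le)) small_mono f.
Proof.
rewrite -[f]mul1r; have QI := is_ideal_gr Z.
apply: (@span_all K (I * bool)%type I M le le_order Q _ 1 (fun i => y i true)) => //.
- exact: spanned0.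
- by move=> g h; exact: spannedD.
- by move=> c g; exact: spannedZ.
- by move=> g Qg; rewrite mul1r; exact: ideal_spanned.
- by move=> i; exact: small_quad.
- by move=> X; exact: small_circuit.
- by move=> X; exact: small_symmetric.
- move=> N NN; rewrite mul1r; apply: (spanned_in QI small_mono).
    exact: enum_uniq.
  by rewrite mem_enum.
case=> i s; right; exists i, (sign_coef K (Some s)).
by apply: (ideal_sym QI); have := @small_sign i (Some s) isT; case: s.
Qed.

Lemma ypoint_inj : injective (@ypoint K I).
Proof.
move=> X Y XY; apply/ffunP => i.
have H s : (X i == Some s) = (Y i == Some s).
  have := congr1 (fun f : {ffun _ -> K} => f (i, s)) XY; rewrite !ffunE /=.
  by case: eqP => _; case: eqP => _ // /eqP; rewrite ?oner_eq0 // eq_sym oner_eq0.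
by have := H true; have := H false; case: (X i) => [[]|]; case: (Y i) => [[]|].
Qed.

Lemma small_basis :
  basis_family (enum (NBC M le)) (fun N => orbit_pi Z (small_mono N)).
Proof.
apply: (orbit_basis (dg := fun N : {set I} => #|N|)).
- by rewrite map_inj_uniq ?enum_uniq //; exact: ypoint_inj.
- by rewrite size_map -!cardE; exact: NBC_card.
- by move=> N; apply: homog_prod_card => i _; exact: cvar_homog.
- exact: small_span.
Qed.

Lemma small_mono_piece N :
  orbit_pi Z (small_mono N) \in gpiece (orbit_harmonics Z) #|N|.
Proof.
apply/quot_pieceP; exists (small_mono N) => //.
by apply: homog_prod_card => i _; exact: cvar_homog.
Qed.

End SmallLocus.

(** * The big locus *)

(** A covector vanishes on [C] exactly when it vanishes on the closure of [C]. *)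
Lemma closure_flat (I : finType) (M : {set signed I}) (C F : {set I}) X : is_COM M ->
  closure_is M C F -> X \in M -> (C \subset flat_of X) = (F \subset flat_of X).
Proof.
move=> M_COM /(closure_isP M_COM)[_ CF Fmin] XM; apply/idP/idP => [|FX].
  by apply: Fmin; exact: imset_f.
exact: subset_trans CF FX.
Qed.

(** A covector [Y] that agrees with [X] off [D], and agrees with [X] or vanishes on
    [D], would be completed to a covector above [X]: compose it with an extension of
    the proper part of [X] supported in [D]. This is what makes the shift of part of
    the variables of a symmetric circuit by [z_i] harmless. *)
Lemma circuit_no_weak (I : finType) (M : {set signed I}) (D : {set I}) X Y : is_COM M ->
  circuit M X -> ~~ (supp X \subset D) -> Y \in M ->
  ~ (forall i, X i != None -> Y i = X i \/ (i \in D /\ Y i = None)).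
Proof.
move=> M_COM cX /subsetPn[k kX kD] YM YX; have [_ /forallP cX2] := andP cX.
pose P : signed I := [ffun i => if i \in D then X i else None].
have /exists_inP[W WM /scomp_fixP WP] : [exists W in M, scomp P W == W].
  apply: (implyP (cX2 P)); apply/andP; split; last first.
    by apply/forallP=> i; rewrite ffunE; case: ifP => _; rewrite eqxx ?orbT.
  apply: contraTneq kX => PX; rewrite inE -PX ffunE (negPf kD).
  by rewrite eqxx.
apply: (no_covector_above cX (scomp_mem M_COM YM WM)) => i Xi; rewrite ffunE.
have [->|[iD ->]] := YX i Xi; first by rewrite Xi.
have Pi : P i = X i by rewrite ffunE iD.
by rewrite eqxx /= WP Pi.
Qed.

Lemma ideal_gen_sub (K : fieldType) (A : comAlgType K) (G Q : A -> Prop) f :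
  is_ideal Q -> (forall g, G g -> Q g) -> f \in ideal_gen G -> Q f.
Proof.
move=> QI GQ /ideal_genP[s Gs ->]; rewrite big_seq.
apply: (big_ind Q) => [|g h|p ps]; first exact: ideal0.
  exact: idealD.
by apply: idealMl => //; apply: GQ; exact: Gs.
Qed.

Lemma total_order_ground (I : finType) (F : {set I}) (le : rel I) :
  total_order le -> total_order (@ground_le I F le).
Proof.
case=> tot tr anti.
by split=> [i j|j i k|i j ij]; [exact: tot|exact: tr|apply/val_inj/anti].
Qed.

Section BigLocus.
Variables (K : fieldType) (I : finType) (M : {set signed I}).
Hypothesis M_COM : is_COM M.
Local Notation Z := (big_locus K M).
Local Notation A := (coordRing K (I * option bool)%type).
Local Notation v i s := (cvar K (i, s)).
Implicit Types (B C F N : {set I}) (X Y : signed I).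
Local Notation zprod := (zprod K).

Lemma big_locusP w : reflect (exists2 X, X \in M & w = zpoint K X) (w \in Z).
Proof. exact: imageP. Qed.

Lemma vanishing_bigP (f : A) :
  (forall X, X \in M -> peval (zpoint K X) f = 0) -> f \in vanishing_ideal Z.
Proof. by move=> H; apply/vanishingP => w /big_locusP[X XM ->]; exact: H. Qed.

Lemma peval_big X (i : I) s : peval (zpoint K X) (v i s) = (X i == s)%:R.
Proof. by rewrite peval_var ffunE. Qed.

Lemma peval_zprod X C : peval (zpoint K X) (zprod C) = (C \subset flat_of X)%:R.
Proof.
rewrite /Defs.zprod peval_prod; case: (boolP (C \subset _)) => [/flat_ofP CX|/subsetPn[i iC]].
  by rewrite big1 // => i /CX Xi; rewrite peval_big Xi eqxx.
by rewrite inE => /negPf Xi; rewrite (bigD1 i) //= peval_big Xi mul0r.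
Qed.

Lemma zprod_homog C : zprod C \is #|C|.-homog.
Proof. by apply: homog_prod_card => i _; exact: cvar_homog. Qed.

Lemma msize_cvar (t : I * option bool) : (msize (cvar K t) <= 2)%N.
Proof. exact: msize_homog (cvar_homog _ _). Qed.

Lemma big_quad (i : I) s t : v i s * v i t \in gr_ideal Z.
Proof.
have [<-|st] := eqVneq s t; last first.
  apply: (homog_vanishing (dhomogM (cvar_homog _ _) (cvar_homog _ _))); apply: vanishing_bigP => X _.
  rewrite pevalM !peval_big; case: eqP => [->|_]; last by rewrite mul0r.
  by rewrite (negPf st) mulr0.
apply: (gr_ideal_top (r := - v i s) (dhomogM (cvar_homog _ _) (cvar_homog _ _))).
  by rewrite -scaleN1r; apply: leq_trans (msizeZ_le _ _) _; exact: msize_cvar.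
apply: vanishing_bigP => X _.
by rewrite pevalB pevalM !peval_big; case: eqP => _; rewrite ?mulr1 ?mulr0 subrr.
Qed.

Lemma big_linear (i : I) : v i (Some true) + v i (Some false) + v i None \in gr_ideal Z.
Proof.
apply: (@gr_ideal_top _ _ _ 1 _ (-1)).
- by rewrite !rpredD ?cvar_homog.
- by rewrite -scaleN1r; apply: leq_trans (msizeZ_le _ _) _; rewrite msize1.
apply: vanishing_bigP => X _; rewrite pevalB !pevalD peval1 !peval_big.
by case: (X i) => [[]|]; rewrite /= ?addr0 ?add0r subrr.
Qed.

Lemma big_zprod_diff C C' F : closure_is M C F -> closure_is M C' F ->
  zprod C - zprod C' \in vanishing_ideal Z.
Proof.
move=> cC cC'; apply: vanishing_bigP => X XM; rewrite pevalB !peval_zprod.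
by rewrite (closure_flat M_COM cC XM) (closure_flat M_COM cC' XM) subrr.
Qed.

(** If [C] lies in a flat, some proper subset [C'] has the same closure, and the
    monomial of [C] is the top form of its difference with that of [C']. *)
Lemma big_nonbasic C : nonbasic M C -> zprod C \in gr_ideal Z.
Proof.
rewrite /nonbasic negb_exists => /forallP nb.
have [/exists_inP[G GM CG]|nG] := boolP [exists G in flats M, C \subset G]; last first.
  apply: (homog_vanishing (zprod_homog C)); apply: vanishing_bigP => X XM.
  rewrite peval_zprod; case: (boolP (C \subset _)) => // CX; case/negP: nG.
  by apply/exists_inP; exists (flat_of X) => //; exact: imset_f.
have [F cC] := closure_exists GM CG; have := nb F; rewrite /basic cC.
have [_ CF _] := closure_isP M_COM _ _ cC; rewrite CF /=.
case/forallPn => C'; rewrite negb_imply => /andP[/andP[C'C cC'] C'ne].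
apply: (gr_ideal_top (r := - zprod C') (zprod_homog C)); last exact: big_zprod_diff cC cC'.
rewrite -scaleN1r; apply: leq_trans (msizeZ_le _ _) _.
apply: leq_trans (msize_homog (zprod_homog C')) _.
by apply: proper_card; rewrite properEneq C'ne.
Qed.

Lemma big_basic F B B' : basic M F B -> basic M F B' ->
  zprod B - zprod B' \in gr_ideal Z.
Proof.
move=> bB bB'; apply: (homog_vanishing (d := #|B|)).
  by rewrite rpredB ?zprod_homog // (basic_card M_COM bB bB') zprod_homog.
by case/and3P: bB => _ cB _; case/and3P: bB' => _ cB' _; exact: big_zprod_diff cB cB'.
Qed.

Lemma basic_flat F B X : basic M F B -> X \in M ->
  (B \subset flat_of X) = (F \subset flat_of X).
Proof. by case/and3P=> _ cB _; exact: closure_flat. Qed.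

Lemma big_flat F B (i : I) (s : bool) : basic M F B -> i \in F ->
  zprod B * v i (Some s) \in gr_ideal Z.
Proof.
move=> bB iF; apply: (homog_vanishing (dhomogM (zprod_homog B) (cvar_homog _ _))).
apply: vanishing_bigP => X XM; rewrite pevalM peval_zprod peval_big (basic_flat bB XM).
by case: (boolP (F \subset _)) => [/flat_ofP/(_ i iF)->|_]; rewrite ?mulr0 ?mul0r.
Qed.

Lemma restrict_mem F X : X \in M -> F \subset flat_of X -> restrict F X \in contraction M F.
Proof. by move=> XM /flat_ofP XF; apply/contractionP; exists X. Qed.

(** The monomial of a basic set of [F] is the indicator function of the covectors
    vanishing on [F], which are those of the contraction. *)
Lemma big_vanish F B (f : A) : basic M F B ->
  (forall X, X \in M -> restrict F X \in contraction M F -> peval (zpoint K X) f = 0) ->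
  zprod B * f \in vanishing_ideal Z.
Proof.
move=> bB H; apply: vanishing_bigP => X XM; rewrite pevalM peval_zprod (basic_flat bB XM).
case: (boolP (F \subset _)) => [FX|_]; last by rewrite mul0r.
by rewrite H ?mulr0 // restrict_mem.
Qed.

Lemma big_circuit F B (X : signed {i : I | i \notin F}) :
  basic M F B -> circuit (contraction M F) X ->
  zprod B * \prod_(i in supp X) v (val i) (X i) \in gr_ideal Z.
Proof.
move=> bB cX; apply: (homog_vanishing (d := (#|B| + #|supp X|)%N)).
  apply: (dhomogM (zprod_homog B)); apply: homog_prod_card => i _; exact: cvar_homog.
apply: (big_vanish bB) => Y YM YF; rewrite peval_prod.
apply/eqP/negPn/negP => /prodf_neq0 H; apply: (no_covector_above cX YF) => i Xi.
have := H i; rewrite inE => /(_ Xi); rewrite peval_big ffunE.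
by case: (_ =P X i) => // _; rewrite eqxx.
Qed.

(** The products of the [t i] and of the [1 - t i] both exclude all covectors by
    [circuit_no_weak], applied to [X] with [D] and to [-X] with the complement of
    [D]; this uses that [D] is proper, respectively nonempty. *)
Lemma big_symmetric F B (X : signed {i : I | i \notin F}) (D : {set {i : I | i \notin F}}) :
  basic M F B -> symmetric_circuit (contraction M F) X ->
  D != set0 -> D \proper supp X ->
  zprod B * elem_sym #|supp X|.-1 (supp X)
    (fun i => if i \in D then v (val i) (X i) + v (val i) None
              else v (val i) (X i)) \in gr_ideal Z.
Proof.
move=> bB /andP[cX cNX] /set0Pn[k kD] /properP[DX [l lX lD]].
have MF_COM := contraction_COM M_COM F.
apply: (gr_ideal_elem_sym (zprod_homog B)).
- by move=> i _; case: ifP => _; rewrite ?rpredD ?cvar_homog.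
- by apply/set0Pn; exists k; exact: (subsetP DX).
- apply: (big_vanish bB) => Y YM YF; rewrite peval_prod.
  apply/eqP/negPn/negP => /prodf_neq0 H.
  apply: (circuit_no_weak (D := D) MF_COM cX _ YF).
    by apply/subsetPn; exists l.
  move=> i Xi; have := H i; rewrite inE => /(_ Xi); rewrite ffunE.
  case: ifP => iD; rewrite ?pevalD !peval_big.
    case: (_ =P X i) => [|_]; first by left.
    by case: (_ =P None) => [|_]; [right|rewrite addr0 eqxx].
  by case: (_ =P X i) => [|_]; [left|rewrite eqxx].
apply: (big_vanish bB) => Y YM YF; rewrite peval_prod.
apply/eqP/negPn/negP => /prodf_neq0 H.
apply: (circuit_no_weak (D := ~: D) MF_COM cNX _ YF).
  apply/subsetPn; exists k; last by rewrite inE negbK.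
  have := subsetP DX k kD; rewrite !inE ffunE.
  by case: (X k) => [[]|].
move=> i; rewrite ffunE => Xi'; have Xi : X i != None by case: (X i) Xi'.
have := H i; rewrite inE => /(_ Xi); rewrite !ffunE pevalB peval1 inE.
case: ifP => iD; rewrite ?pevalD !peval_big.
  by case: (X i) Xi => [[]|] // _; case: (Y (val i)) => [[]|] /=;
     rewrite ?addr0 ?add0r ?subrr ?eqxx //; left.
by case: (X i) Xi => [[]|] // _; case: (Y (val i)) => [[]|] /=;
   rewrite ?subrr ?eqxx //; (by left) || (by right).
Qed.

Lemma zpoint_inj : injective (@zpoint K I).
Proof.
move=> X Y XY; apply/ffunP => i; apply/eqP.
have := congr1 (fun f : {ffun _ -> K} => f (i, Y i)) XY; rewrite !ffunE /= eqxx.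
by case: eqP => // _ /eqP; rewrite eq_sym oner_eq0.
Qed.

Variable J : forall F : {set I},
  signed {i : I | i \notin F} -> {set {i : I | i \notin F}}.
Hypothesis J_proper : forall F (X : signed {i : I | i \notin F}), F \in flats M ->
  symmetric_circuit (contraction M F) X ->
  J X != set0 /\ J X \proper supp X.
Local Notation hat := (hat_ideal K M J).

Lemma is_ideal_hat : is_ideal (fun f => f \in hat).
Proof.
have hatP (f : A) :
    reflect (exists2 g, g \in ideal_gen (hat_gen M J) & f - g \in tilde_ideal M) (f \in hat).
  exact: asboolP.
split=> [|f f' /hatP[g Ig Ifg] /hatP[g' Ig' Ifg']|a f /hatP[g Ig Ifg]]; apply/hatP.
- by exists 0; rewrite ?subrr; exact: rpred0.
- exists (g + g'); first exact: rpredD.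
  by rewrite opprD addrACA; exact: rpredD.
- exists (a * g); first exact: ideal_gen_mull.
  by rewrite -mulrBr; exact: ideal_gen_mull.
Qed.

Lemma hat_gen_in f : hat_gen M J f -> f \in hat.
Proof.
move=> Gf; apply/asboolP; exists f; first exact: ideal_gen_in.
by rewrite subrr; exact: rpred0.
Qed.

Lemma tilde_gen_in f : tilde_gen M f -> f \in hat.
Proof.
move=> Gf; apply/asboolP; exists 0; first exact: rpred0.
by rewrite subr0; exact: ideal_gen_in.
Qed.

Lemma hat_sub_gr f : f \in hat -> f \in gr_ideal Z.
Proof.
have QI := is_ideal_gr Z.
case/asboolP=> g Ig; rewrite -{2}(subrK g f) => Ifg; apply: (idealD QI).
  apply: (ideal_gen_sub QI) Ifg => _ [C nC|F B B' bB bB'|i].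
  - exact: big_nonbasic.
  - exact: big_basic bB bB'.
  - exact: big_quad.
apply: (ideal_gen_sub QI) Ig => _ [i s t|i|F B i s bB iF|F B X bB cX|F B X bB sX].
- exact: big_quad.
- exact: big_linear.
- exact: big_flat bB iF.
- exact: big_circuit.
- have [FM _ _ _] := basicP M_COM _ _ bB; have [J0 JX] := J_proper FM sX.
  exact: big_symmetric.
Qed.

Variables (le : rel I) (B : {set I} -> {set I}).
Hypothesis le_order : total_order le.
Hypothesis B_basic : forall F, F \in flats M -> basic M F (B F).

Local Notation flatType := {F : {set I} | F \in flats M}.

Definition nbc_sets (F : {set I}) : seq {set {i : I | i \notin F}} :=
  enum (NBC (contraction M F) (@ground_le I F le)).

Definition big_index := dsum_index (fun F : flatType => nbc_sets (val F)).

Definition big_mono (u : {F : flatType & {set {i : I | i \notin val F}}}) : A :=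
  zprod (B (val (tag u))) * \prod_(i in tagged u) v (val i) (Some true).

Definition big_deg (u : {F : flatType & {set {i : I | i \notin val F}}}) : nat :=
  (#|B (val (tag u))| + #|tagged u|)%N.

Lemma big_index_uniq : uniq big_index.
Proof.
apply: allpairs_uniq_dep; [exact: enum_uniq|by move=> F _; exact: enum_uniq|].
by move=> [F N] [F' N'] _ _.
Qed.

Lemma map_val_flats : map val (enum {: flatType}) = enum (flats M).
Proof.
have -> : enum {: flatType} = pmap insub (enum {set I}).
  by rewrite !enumT [in LHS]unlock.
rewrite pmap_filter; last exact: insubK.
rewrite enumT /enum_mem; apply: eq_filter => F; exact: isSome_insub.
Qed.

Lemma hat_monomialsE : hat_monomials K M le B = [seq big_mono u | u <- big_index].
Proof.
rewrite /hat_monomials /image_mem -map_val_flats -map_comp map_flatten.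
congr flatten; rewrite -[RHS]map_comp; apply: eq_map => F /=.
rewrite -map_comp /nbc_monomials /image_mem.
by rewrite -map_comp.
Qed.

(** Both sides count covectors by their flat: the contraction by [F] has at most as
    many NBC sets as topes. *)
Lemma big_index_size : (size big_index <= size Z)%N.
Proof.
rewrite size_map -cardE -(sum_card_flats M) size_allpairs_dep sumnE big_map.
rewrite -big_enum -map_val_flats [leqRHS]big_map; apply: leq_sum => F _.
rewrite -cardE; apply: leq_trans (card_topes_contraction M (val F)).
by apply: NBC_card; [exact: contraction_COM|exact: total_order_ground].
Qed.

Lemma big_mono_homog u : big_mono u \is (big_deg u).-homog.
Proof.
apply: dhomogM; first exact: zprod_homog.
by apply: homog_prod_card => i _; exact: cvar_homog.
Qed.

Local Notation hatspan := (spanned (fun f => f \in hat) big_index big_mono).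

(** Induction from large flats to small ones. Multiplying the monomial of [F] by any
    [z_i] gives zero or the monomial of a larger flat, which is already spanned. So
    after multiplication by this monomial the [z_i] may be ignored, and what remains
    are the relations of the small locus of the contraction, to which [span_all]
    applies. *)
Lemma flat_span F (g : A) : F \in flats M -> hatspan (zprod (B F) * g).
Proof.
have HI := is_ideal_hat.
have [k] := ubnP #|~: F|; elim: k => // k IHk in F g * => Fk FM.
have bB := B_basic FM; have [_ BF Fmin Bmin] := basicP M_COM _ _ bB.
set p := zprod (B F).
pose Q (f : A) := forall h, hatspan (p * f * h).
have QI : is_ideal Q.
  split=> [h|f f' Qf Qf' h|a f Qf h].
  - by rewrite mulr0 mul0r; exact: (spanned0 HI).
  - by rewrite mulrDr mulrDl; apply: (spannedD HI); [exact: Qf|exact: Qf'].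
  - by rewrite [a * f]mulrC -!mulrA mulrA; exact: Qf.
have hatQ f : p * f \in hat -> Q f.
  by move=> Hf h; apply: ideal_spanned; exact: (idealMr HI).
have hatQ' f : f \in hat -> Q f.
  by move=> Hf; apply: hatQ; exact: (idealMl HI).
have zQ i : Q (v i None).
  (* If [i] is in the basic set a square appears; otherwise [i |: B F] is nonbasic or
     basic for a flat strictly above [F]. *)
  have [iB|iB] := boolP (i \in B F).
    apply: hatQ; rewrite /p /Defs.zprod (big_setD1 i iB) /= mulrC mulrA.
    by apply: (idealMr HI); apply: tilde_gen_in; exact: TildeSquare.
  have pE : p * v i None = zprod (i |: B F).
    by rewrite /Defs.zprod big_setU1 //= mulrC.
  have [nb|] := boolP (nonbasic M (i |: B F)).
    by apply: hatQ; rewrite pE; apply: tilde_gen_in; exact: TildeNonbasic.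
  rewrite negbK => /existsP[F' bB'] h; rewrite pE.
  have [F'M BF' _ Bmin'] := basicP M_COM _ _ bB'.
  have FF' : F \subset F'.
    by apply: Fmin => //; apply: subset_trans BF'; exact: subsetUr.
  have FneF' : F != F'.
    apply/eqP=> E; have := Bmin' i (setU11 _ _); rewrite setU1K // -E.
    by case/and3P: bB => _ -> _.
  apply: (spanned_congr HI (g := zprod (B F') * h)).
    rewrite -mulrBl; apply: (idealMr HI); apply: tilde_gen_in.
    by apply: TildeBasic bB' _; exact: B_basic.
  apply: IHk => //; rewrite -ltnS; apply: leq_trans Fk; rewrite ltnS.
  by apply: proper_card; rewrite properC properEneq FneF'.
have sgnQ i (s : option bool) : s != None -> Q (sign_coef K s *: v i (Some true) - v i s).
  case: s => [[]|] // _; rewrite /sign_coef /= ?scale1r ?subrr; first exact: (ideal0 QI).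
  rewrite scaleN1r -opprD; apply: (idealN QI).
  have -> : v i (Some true) + v i (Some false) =
    (v i (Some true) + v i (Some false) + v i None) - v i None by rewrite addrK.
  apply: (idealB QI) => //; apply: hatQ'; apply: hat_gen_in; exact: HatLinear.
have ground_order := @total_order_ground I F le le_order.
apply: (@span_all K _ _ (contraction M F) _ ground_order Q _ p
  (fun i => v (val i) (Some true)) QI) => //.
- exact: (spanned0 HI).
- by move=> f h; exact: (spannedD HI).
- by move=> c f; exact: (spannedZ HI).
- by move=> f Qf; rewrite -[_ * f]mulr1; exact: Qf.
- by move=> i; apply: hatQ'; apply: hat_gen_in; exact: HatQuad.
- move=> X cX; apply: (ideal_congr QI (g := \prod_(i in supp X) v (val i) (X i))).
    by apply: (prod_congr QI) => i; rewrite inE; exact: sgnQ.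
  by apply: hatQ; apply: hat_gen_in; exact: HatCircuit.
- move=> X sX _; apply: (ideal_congr QI (g := elem_sym #|supp X|.-1 (supp X)
    (fun i => if i \in J X then v (val i) (X i) + v (val i) None else v (val i) (X i)))).
    apply: (elem_sym_congr QI) => i; rewrite inE => Xi; case: ifP => _; last exact: sgnQ.
    by rewrite opprD addrA; apply: (idealB QI); [exact: sgnQ|exact: zQ].
  by apply: hatQ; apply: hat_gen_in; exact: HatSymmetric.
- move=> N NN; pose u : {F : flatType & {set {i : I | i \notin val F}}} :=
    Tagged (fun F : flatType => {set {i : I | i \notin val F}})
      (N : {set {i : I | i \notin val (Sub F FM : flatType)}}).
  apply: (spanned_in HI big_mono (u := u) big_index_uniq).
  apply/allpairsPdep; exists (Sub F FM), N; split=> //; by rewrite mem_enum.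
case=> i [s|]; last by left; exact: zQ.
have [iF|iF] := boolP (i \in F).
  by left; apply: hatQ; apply: hat_gen_in; exact: (HatFlat _ _ _ bB iF).
right; exists (Sub i iF), (sign_coef K (Some s)).
by apply: (ideal_sym QI); exact: sgnQ.
Qed.

(** The empty set is nonbasic, and then [1] is in the ideal, or it is basic for the
    least flat, whose monomial is congruent to [1]. *)
Lemma big_span (f : A) : hatspan f.
Proof.
have HI := is_ideal_hat.
have z0 : zprod (set0 : {set I}) = 1 by apply: big1 => i; rewrite inE.
have [nb|] := boolP (nonbasic M set0).
  apply: ideal_spanned; rewrite -[f]mulr1; apply: (idealMl HI).
  by rewrite -z0; apply: tilde_gen_in; exact: TildeNonbasic.
rewrite negbK => /existsP[F b0]; have [FM _ _ _] := basicP M_COM _ _ b0.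
apply: (spanned_congr HI (g := zprod (B F) * f)); last exact: flat_span.
rewrite -{1}[f]mul1r -z0 -mulrBl; apply: (idealMr HI); apply: tilde_gen_in.
by apply: TildeBasic b0 _; exact: B_basic.
Qed.

End BigLocus.

Theorem theorem4p14 (K : fieldType) (I : finType) (M : {set signed I})
    (le : rel I) (B : {set I} -> {set I})
    (J : forall F : {set I},
       signed {i : I | i \notin F} -> {set {i : I | i \notin F}})
    (M_COM : is_COM M)
    (le_order : total_order le)
    (B_basic : forall F, F \in flats M -> basic M F (B F))
    (J_proper : forall F X, F \in flats M ->
       symmetric_circuit (contraction M F) X ->
       J F X != set0 /\ J F X \proper supp X) :
  [/\ hat_ideal K M J =i gr_ideal (big_locus K M),
      is_basis [seq orbit_pi (big_locus K M) m | m <- hat_monomials K M le B]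
    & graded_iso (orbit_harmonics (big_locus K M))
        (gdsum (fun F : {F : {set I} | F \in flats M} =>
           gshift (orbit_harmonics (small_locus K (contraction M (val F))))
                  (codim M (val F))))].
Proof.
have hspan := @big_span K I M M_COM J le B le_order B_basic.
have hat_gr := @hat_sub_gr K I M M_COM J J_proper.
have uniqZ : uniq (big_locus K M).
  by rewrite map_inj_uniq ?enum_uniq //; exact: zpoint_inj.
have le_size := big_index_size K M_COM le_order.
have hhomog := @big_mono_homog K I M B.
have gr_span f : exists c,
    f - \sum_(u <- big_index M le) c u *: big_mono K B u \in gr_ideal (big_locus K M).
  by have [c cE] := hspan f; exists c; exact: hat_gr.
have hbasis := orbit_basis uniqZ le_size hhomog gr_span.
split.
- move=> f; apply/idP/idP => [|If]; first exact: hat_gr.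
  have [c cE] := hspan f; have := hat_gr _ cE => /(rpredB If); rewrite opprB addrC subrK.
  move=> /(gr_ideal_indep uniqZ le_size hhomog gr_span) c0.
  move: cE; rewrite big_seq big1 ?subr0 // => u /c0 ->; exact: scale0r.
- rewrite hat_monomialsE -map_comp; apply: is_basis_map => //.
  exact: big_index_uniq.
pose b (F : {F : {set I} | F \in flats M}) (N : {set {i : I | i \notin val F}}) :
    gshift (orbit_harmonics (small_locus K (contraction M (val F)))) (codim M (val F)) :=
  orbit_pi _ (small_mono K N).
apply: (graded_iso_basis (dg := @big_deg I M B) hbasis
   (dsum_basis (L := fun F : {F : {set I} | F \in flats M} => nbc_sets M le (val F)) (b := b) _)).
- move=> F; apply: small_basis; first exact: contraction_COM.
  exact: total_order_ground.
- by move=> u _; apply/quot_pieceP; exists (big_mono K B u).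
move=> [F N] _; apply: dsum_emb_piece.
suff : orbit_pi (small_locus K (contraction M (val F))) (small_mono K N) \in
    shift_piece (codim M (val F)) (#|B (val F)| + #|N|) by [].
rewrite shift_pieceE (codimE M_COM (B_basic _ (valP F))) leq_addr addKn.
exact: small_mono_piece.
Qed.
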